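(* Let $R$ be a reduced Noetherian ring of positive prime characteristic $p$ with a square locally stable test element $c \in R^\circ$, and let $I \subseteq R$ be an ideal. Then the following are equivalent: (1) $(I_W)^* = (I^* )_W$ for all multiplicatively closed sets $W$ in $R$. (2) For every $x \in R$, the set $T_I(x)$ is finite (or: the set $T_I$ is finite); and, for every $x \in R$ and every $Q \in T_I(x)$, there exists an integer $N$, possibly depending on $Q$, such that $Q^{Nq} \subseteq (I^{[q]} :_R cx^q)_Q$ for all $q \gg 0$ (or: for every $x \in R$ and every $Q \in T_I(x)$, there exists an integer $N$, possibly depending on $Q$, such that $Q^{Nq} \subseteq ((I^{[q]})^* :_R cx^q)_Q$ for all $q \gg 0$). (That is, (1) is equivalent to each of the four conjunctions obtained by choosing one of the two finiteness requirements, ''$T_I(x)$ is finite for every $x \in R$'' or ''$T_I$ is finite'', and one of the two containment requirements, the one with $(I^{[q]} :_R cx^q)_Q$ or the one with $((I^{[q]})^* :_R cx^q)_Q$.)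
   Context: Throughout, $q$ denotes a power $p^e$, $e \in \mathbb{N}$, of $p$. $R^\circ$ denotes the complement in $R$ of the union of the minimal primes of $R$. For an ideal $I$, $I^{[q]}$ is the ideal generated by the $q$-th powers of elements of $I$, and the tight closure $I^*$ is the set of $u \in R$ for which there is $d \in R^\circ$ with $du^q \in I^{[q]}$ for all $q \gg 0$. $I_W$ denotes $IR_W$, and $(I_W)^*$ is its tight closure in $R_W$. More generally, for finitely generated modules $N \subseteq M$, $N^{[q]}$ ($q=p^e$) is the image of $F^e(N)\to F^e(M)$, where $F^e$ is base change along the $e$-th iterate of Frobenius, $u^q := 1\otimes u \in F^e(M)$ for $u\in M$, and $N^*$ is the set of $u\in M$ such that for some $d \in R^\circ$, $du^q\in N^{[q]}$ for all $q\gg0$. A test element is an element $c \in R^\circ$ such that for all finitely generated $N \subseteq M$ and $u \in M$: $u \in N^*$ if and only if $cu^q \in N^{[q]}$ for all $q$. It is locally stable if its image in every local ring of $R$ is a test element of that ring. A square locally stable test element is one of the form $c = d^2$ with $d$ a locally stable test element. For an ideal $I$ and $x \in R$, $T_I(x)$ (the set of stable primes associated to $I$ and $x$) is the set of primes $Q$ of $R$ such that $x \notin (I_Q)^*$ while $x \in (I_P)^*$ for all primes $P \subsetneq Q$ (equivalently, $Q$ is minimal over $I^{[q]} :_R cx^q$ for all $q \gg 0$, for some, equivalently every, locally stable test element $c$). $T_I = \bigcup_{x \in R} T_I(x)$. *)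

(* Defs.v *)
From HB Require Import structures.
From mathcomp Require Import all_boot all_algebra ring.
From mathcomp Require Import boolp classical_sets cardinality.

Set Implicit Arguments.
Unset Strict Implicit.
Unset Printing Implicit Defensive.

Import GRing.Theory.
Local Open Scope ring_scope.
Local Open Scope classical_set_scope.
Local Open Scope quotient_scope.

(* Rings are [comPzRingType], i.e. possibly zero, because a localization of a *)
(* nonzero ring can be the zero ring (when 0 belongs to the multiplicatively  *)
(* closed set). Ideals and submodules are [set]s.                             *)

Section Modules.
Variables (R : pzRingType) (M : lmodType R).

Definition submodule (N : set M) : Prop :=
  N 0 /\ forall (a : R) (u v : M), N u -> N v -> N (a *: u + v).

Definition submodule_gen (A : set M) : set M := smallest submodule A.

Definition fg_submodule (N : set M) : Prop :=
  exists s : seq M, N = submodule_gen [set` s].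

Definition fg_module : Prop := fg_submodule setT.

End Modules.

Arguments fg_module {R} M.

Section Ideals.
Variable R : comPzRingType.

Definition ideal (I : set R) : Prop := @submodule R R^o I.

Definition ideal_gen (A : set R) : set R := @submodule_gen R R^o A.

Definition noetherian : Prop :=
  forall I : set R, ideal I -> @fg_submodule R R^o I.

Definition reduced : Prop := forall (x : R) (n : nat), x ^+ n = 0 -> x = 0.

Definition is_prime (P : set R) : Prop :=
  [/\ ideal P, ~ P 1 & forall a b : R, P (a * b) -> P a \/ P b].

Record prime_ideal := PrimeIdeal {
  prime_set :> set R;
  prime_setP : is_prime prime_set }.

Definition minimal_prime (P : prime_ideal) : Prop :=
  forall Q : prime_ideal, Q `<=` P -> P `<=` Q.

Definition ring_circ : set R :=
  ~` \bigcup_(P in minimal_prime) (P : set R).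

Definition ideal_colon (I : set R) (y : R) : set R := [set r | I (r * y)].

(* The case n = 0 is the unit ideal, generated by the empty product. *)
Definition ideal_pow (I : set R) (n : nat) : set R :=
  ideal_gen [set y | exists2 a : 'I_n -> R,
                       (forall i, I (a i)) & y = \prod_(i < n) a i].

Record mulset := MulSet {
  mulset_set :> set R;
  mulset1 : mulset_set 1;
  mulsetM : forall a b : R, mulset_set a -> mulset_set b -> mulset_set (a * b) }.

End Ideals.

Arguments noetherian : clear implicits.
Arguments reduced : clear implicits.
Arguments prime_ideal : clear implicits.
Arguments ring_circ : clear implicits.
Arguments mulset : clear implicits.

(* R_W, as the quotient of the pairs (r, w), w in W, by the relation          *)
(* (r, w) ~ (r', w') iff t r w' = t r' w for some t in W.                     *)
Section Localization.
Variables (R : comPzRingType) (W : mulset R).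

Local Notation den := {w : R | w \in (W : set R)}.
Local Notation pre := (R * den)%type.

Implicit Types (x y z : pre).

Definition loc_rel x y : bool :=
  `[< exists2 t, mulset_set W t & t * (x.1 * val y.2) = t * (y.1 * val x.2) >].

Lemma denP (w : den) : mulset_set W (val w).
Proof. by apply: set_mem; exact: valP. Qed.

Lemma loc_rel_refl : reflexive loc_rel.
Proof. by move=> x; apply/asboolP; exists 1 => //; exact: mulset1. Qed.

Lemma loc_rel_sym : symmetric loc_rel.
Proof.
by move=> x y; apply/asboolP/asboolP => -[t Wt e]; exists t.
Qed.

Lemma loc_rel_trans : transitive loc_rel.
Proof.
move=> y x z /asboolP[t Wt e] /asboolP[s Ws e']; apply/asboolP.
exists (t * s * val y.2).
  by apply: mulsetM (denP _); exact: mulsetM.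
have -> : t * s * val y.2 * (x.1 * val z.2) =
          s * val z.2 * (t * (x.1 * val y.2)) by ring.
have -> : t * s * val y.2 * (z.1 * val x.2) =
          t * val x.2 * (s * (z.1 * val y.2)) by ring.
by rewrite e -e'; ring.
Qed.

Canonical loc_equiv := EquivRel loc_rel loc_rel_refl loc_rel_sym loc_rel_trans.

Definition loc := {eq_quot loc_rel}.

HB.instance Definition _ : EqQuotient _ loc_rel loc := EqQuotient.on loc.
HB.instance Definition _ := Choice.on loc.

Definition den1 : den := exist _ 1 (mem_set (mulset1 W)).

Definition denM (v w : den) : den :=
  exist _ (val v * val w) (mem_set (mulsetM (denP v) (denP w))).

Definition loc_frac (r : R) (w : den) : loc := \pi_loc (r, w).

Definition loc_add (a b : loc) : loc :=
  let x := repr a in let y := repr b in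
  loc_frac (x.1 * val y.2 + y.1 * val x.2) (denM x.2 y.2).

Definition loc_opp (a : loc) : loc := loc_frac (- (repr a).1) (repr a).2.

Definition loc_mul (a b : loc) : loc :=
  let x := repr a in let y := repr b in
  loc_frac (x.1 * y.1) (denM x.2 y.2).

Lemma loc_eqP (r r' : R) (w w' : den) :
  (loc_frac r w = loc_frac r' w') <->
  exists2 t, mulset_set W t & t * (r * val w') = t * (r' * val w).
Proof.
split=> [/eqmodP/asboolP//|h]; apply/eqmodP; exact/asboolP.
Qed.

Lemma loc_reprP (r : R) (w : den) : exists2 t, mulset_set W t &
  t * ((repr (loc_frac r w)).1 * val w) = t * (r * val (repr (loc_frac r w)).2).
Proof.
apply/loc_eqP; rewrite {1}/loc_frac -surjective_pairing.
exact: reprK.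
Qed.

Lemma loc_ind (P : loc -> Prop) :
  (forall r w, P (loc_frac r w)) -> forall a, P a.
Proof. by move=> h a; rewrite -[a]reprK; case: (repr a) => r w; exact: h. Qed.

Lemma loc_addE r w r' w' : loc_add (loc_frac r w) (loc_frac r' w') =
  loc_frac (r * val w' + r' * val w) (denM w w').
Proof.
case: (loc_reprP r w) => t Wt; case: (loc_reprP r' w') => s Ws.
rewrite /loc_add; move: (repr _) (repr _) => [a v] [b v'] /= e' e.
apply/loc_eqP; exists (t * s); first exact: mulsetM.
rewrite /=.
transitivity (s * val v' * val w' * (t * (a * val w)) +
              t * val v * val w * (s * (b * val w'))); first by rewrite /=; ring.
by rewrite /= e e'; ring.
Qed.

Lemma loc_oppE r w : loc_opp (loc_frac r w) = loc_frac (- r) w.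
Proof.
case: (loc_reprP r w) => t Wt; rewrite /loc_opp.
case: (repr _) => a v /= e; apply/loc_eqP; exists t => //.
by rewrite !mulNr !mulrN e.
Qed.

Lemma loc_mulE r w r' w' : loc_mul (loc_frac r w) (loc_frac r' w') =
  loc_frac (r * r') (denM w w').
Proof.
case: (loc_reprP r w) => t Wt; case: (loc_reprP r' w') => s Ws.
rewrite /loc_mul; move: (repr _) (repr _) => [a v] [b v'] /= e' e.
apply/loc_eqP; exists (t * s); first exact: mulsetM.
rewrite /=.
transitivity ((t * (a * val w)) * (s * (b * val w'))); first by rewrite /=; ring.
by rewrite /= e e'; ring.
Qed.

Lemma loc_addA : associative loc_add.
Proof.
elim/loc_ind=> a u; elim/loc_ind=> b v; elim/loc_ind=> c w.
rewrite !loc_addE; congr loc_frac; last by apply: val_inj; rewrite /= mulrA.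
by rewrite /=; ring.
Qed.

Lemma loc_addC : commutative loc_add.
Proof.
elim/loc_ind=> a u; elim/loc_ind=> b v.
rewrite !loc_addE; congr loc_frac; first by rewrite addrC.
by apply: val_inj; rewrite /= mulrC.
Qed.

Lemma loc_add0 : left_id (loc_frac 0 den1) loc_add.
Proof.
elim/loc_ind=> a u; rewrite loc_addE; congr loc_frac.
  by rewrite mul0r add0r mulr1.
by apply: val_inj; rewrite /= mul1r.
Qed.

Lemma loc_addN : left_inverse (loc_frac 0 den1) loc_opp loc_add.
Proof.
elim/loc_ind=> a u; rewrite loc_oppE loc_addE; apply/loc_eqP.
by exists 1; [exact: mulset1|rewrite /= mulNr addNr !mul0r].
Qed.

HB.instance Definition _ :=
  GRing.isZmodule.Build loc loc_addA loc_addC loc_add0 loc_addN.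

Lemma loc_mulA : associative loc_mul.
Proof.
elim/loc_ind=> a u; elim/loc_ind=> b v; elim/loc_ind=> c w.
rewrite !loc_mulE; congr loc_frac; first by rewrite mulrA.
by apply: val_inj; rewrite /= mulrA.
Qed.

Lemma loc_mulC : commutative loc_mul.
Proof.
elim/loc_ind=> a u; elim/loc_ind=> b v.
rewrite !loc_mulE; congr loc_frac; first by rewrite mulrC.
by apply: val_inj; rewrite /= mulrC.
Qed.

Lemma loc_mul1 : left_id (loc_frac 1 den1) loc_mul.
Proof.
elim/loc_ind=> a u; rewrite loc_mulE mul1r; congr loc_frac.
by apply: val_inj; rewrite /= mul1r.
Qed.

Lemma loc_mulDl : left_distributive loc_mul loc_add.
Proof.
elim/loc_ind=> a u; elim/loc_ind=> b v; elim/loc_ind=> c w.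
rewrite !(loc_addE, loc_mulE); apply/loc_eqP; exists 1; first exact: mulset1.
by rewrite /=; ring.
Qed.

HB.instance Definition _ :=
  GRing.Zmodule_isComPzRing.Build loc loc_mulA loc_mulC loc_mul1 loc_mulDl.

Definition to_loc (r : R) : loc := loc_frac r den1.

Definition ideal_loc (I : set R) : set loc := ideal_gen (to_loc @` I).

End Localization.

Arguments to_loc {R} W r.
Arguments ideal_loc {R} W I.

Section LocalizationAtPrime.
Variables (R : comPzRingType) (P : prime_ideal R).

Lemma prime_compl1 : (~` (P : set R)) 1.
Proof. by case: (prime_setP P). Qed.

Lemma prime_complM (a b : R) :
  (~` (P : set R)) a -> (~` (P : set R)) b -> (~` (P : set R)) (a * b).
Proof. by case: (prime_setP P) => _ _ h Pa Pb /h[]. Qed.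

Definition prime_compl : mulset R := MulSet prime_compl1 prime_complM.

End LocalizationAtPrime.

(* The base change B \otimes_A M along f : A -> B, presented as the formal    *)
(* sums of pure tensors [:: (b1, m1); ...; (bn, mn)] modulo the congruence    *)
(* generated by the tensor product relations. The construction makes sense    *)
(* without f being a ring morphism, so this is not required; it will only be  *)
(* used for iterated Frobenius maps.                                          *)
Section BaseChange.
Variables (A B : comPzRingType) (f : A -> B) (M : lmodType A).

Local Notation pre := (seq (B * M)).

Inductive tensor_cong : pre -> pre -> Prop :=
| tensor_refl s : tensor_cong s s
| tensor_sym s t : tensor_cong s t -> tensor_cong t s
| tensor_trans s t u : tensor_cong s t -> tensor_cong t u -> tensor_cong s u
| tensor_cat s s' t t' : tensor_cong s s' -> tensor_cong t t' ->
    tensor_cong (s ++ t) (s' ++ t')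
| tensor_comm s t : tensor_cong (s ++ t) (t ++ s)
| tensor_zero m : tensor_cong [:: (0, m)] [::]
| tensor_addl b b' m : tensor_cong [:: (b + b', m)] [:: (b, m); (b', m)]
| tensor_addr b m m' : tensor_cong [:: (b, m + m')] [:: (b, m); (b, m')]
| tensor_scale a b m : tensor_cong [:: (b * f a, m)] [:: (b, a *: m)].

Definition tensor_rel (s t : pre) : bool := `[< tensor_cong s t >].

Lemma tensor_rel_refl : reflexive tensor_rel.
Proof. by move=> s; apply/asboolP; exact: tensor_refl. Qed.

Lemma tensor_rel_sym : symmetric tensor_rel.
Proof. by move=> s t; apply/asboolP/asboolP; exact: tensor_sym. Qed.

Lemma tensor_rel_trans : transitive tensor_rel.
Proof.
by move=> t s u /asboolP st /asboolP tu; apply/asboolP; exact: tensor_trans tu.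
Qed.

Canonical tensor_equiv :=
  EquivRel tensor_rel tensor_rel_refl tensor_rel_sym tensor_rel_trans.

Definition base_change := {eq_quot tensor_rel}.

HB.instance Definition _ : EqQuotient _ tensor_rel base_change :=
  EqQuotient.on base_change.
HB.instance Definition _ := Choice.on base_change.

Definition bc_class (s : pre) : base_change := \pi_base_change s.

Lemma bc_classP s t : bc_class s = bc_class t <-> tensor_cong s t.
Proof. by split=> [/eqmodP/asboolP//|h]; apply/eqmodP; exact/asboolP. Qed.

Lemma bc_reprP s : tensor_cong (repr (bc_class s)) s.
Proof. by apply/bc_classP; exact: reprK. Qed.

Lemma bc_ind (P : base_change -> Prop) :
  (forall s, P (bc_class s)) -> forall x, P x.
Proof. by move=> h x; rewrite -[x]reprK; exact: h. Qed.

Definition pre_scale (c : B) (s : pre) : pre :=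
  [seq (c * x.1, x.2) | x <- s].

Definition bc_add (x y : base_change) : base_change :=
  bc_class (repr x ++ repr y).
Definition bc_scale (c : B) (x : base_change) : base_change :=
  bc_class (pre_scale c (repr x)).
Definition bc_opp (x : base_change) : base_change := bc_scale (-1) x.

Lemma tensor_pre_scale c s t :
  tensor_cong s t -> tensor_cong (pre_scale c s) (pre_scale c t).
Proof.
elim=> {s t} /=.
- by move=> s; exact: tensor_refl.
- by move=> s t _; exact: tensor_sym.
- by move=> s t u _ st _; exact: tensor_trans.
- by move=> s s' t t' _ ? _ ?; rewrite /pre_scale !map_cat; exact: tensor_cat.
- by move=> s t; rewrite /pre_scale !map_cat; exact: tensor_comm.
- by move=> m; rewrite mulr0; exact: tensor_zero.
- by move=> b b' m; rewrite mulrDr; exact: tensor_addl.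
- by move=> b m m'; exact: tensor_addr.
- by move=> a b m; rewrite mulrA; exact: tensor_scale.
Qed.

Lemma bc_addE s t : bc_add (bc_class s) (bc_class t) = bc_class (s ++ t).
Proof. by apply/bc_classP; apply: tensor_cat; exact: bc_reprP. Qed.

Lemma bc_scaleE c s : bc_scale c (bc_class s) = bc_class (pre_scale c s).
Proof. by apply/bc_classP; apply: tensor_pre_scale; exact: bc_reprP. Qed.

Lemma bc_addA : associative bc_add.
Proof.
elim/bc_ind=> s; elim/bc_ind=> t; elim/bc_ind=> u.
by rewrite !bc_addE catA.
Qed.

Lemma bc_addC : commutative bc_add.
Proof.
elim/bc_ind=> s; elim/bc_ind=> t; rewrite !bc_addE.
by apply/bc_classP; exact: tensor_comm.
Qed.

Lemma bc_add0 : left_id (bc_class [::]) bc_add.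
Proof. by elim/bc_ind=> s; rewrite bc_addE. Qed.

Lemma bc_scaleDl x : {morph bc_scale^~ x : c d / c + d >-> bc_add c d}.
Proof.
elim/bc_ind: x => s c d; rewrite !bc_scaleE bc_addE; apply/bc_classP.
elim: s => [|[b m] s IHs] /=; first exact: tensor_refl.
rewrite -cat1s -[X in tensor_cong _ X]cat1s catA.
apply: (@tensor_trans _ ([:: (c * b, m); (d * b, m)] ++
                         (pre_scale c s ++ pre_scale d s))).
  by apply: tensor_cat => //; rewrite mulrDl; exact: tensor_addl.
rewrite -[[:: _; _]]/([:: (c * b, m)] ++ [:: (d * b, m)]) -!catA.
apply: tensor_cat; first exact: tensor_refl.
rewrite -[X in tensor_cong _ (_ ++ X)]cat1s !catA.
by apply: tensor_cat; [exact: tensor_comm|exact: tensor_refl].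
Qed.

Lemma bc_scale0 x : bc_scale 0 x = bc_class [::].
Proof.
elim/bc_ind: x => s; rewrite bc_scaleE; apply/bc_classP.
elim: s => [|[b m] s IHs] /=; first exact: tensor_refl.
rewrite mul0r -cat1s -[X in tensor_cong _ X]cats0.
by apply: tensor_cat IHs; exact: tensor_zero.
Qed.

Lemma bc_scale1 : left_id 1 bc_scale.
Proof.
elim/bc_ind=> s; rewrite bc_scaleE /pre_scale; congr bc_class.
by rewrite -[RHS]map_id; apply: eq_map => -[b m]; rewrite mul1r.
Qed.

Lemma bc_addN : left_inverse (bc_class [::]) bc_opp bc_add.
Proof.
by move=> x; rewrite -{2}[x]bc_scale1 -bc_scaleDl addNr bc_scale0.
Qed.

HB.instance Definition _ :=
  GRing.isZmodule.Build base_change bc_addA bc_addC bc_add0 bc_addN.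

Lemma bc_scaleA c d x : bc_scale c (bc_scale d x) = bc_scale (c * d) x.
Proof.
elim/bc_ind: x => s; rewrite !bc_scaleE /pre_scale -map_comp.
by congr bc_class; apply: eq_map => -[b m] /=; rewrite mulrA.
Qed.

Lemma bc_scaleDr : right_distributive bc_scale +%R.
Proof.
move=> c; elim/bc_ind=> s; elim/bc_ind=> t.
by rewrite [_ + _]bc_addE !bc_scaleE [RHS]bc_addE /pre_scale map_cat.
Qed.

HB.instance Definition _ := GRing.Zmodule_isLmodule.Build B base_change
  bc_scaleA bc_scale1 bc_scaleDr bc_scaleDl.

Definition tensor (b : B) (m : M) : base_change := bc_class [:: (b, m)].

End BaseChange.

Section TightClosure.
Variables (p : nat) (R : comPzRingType).

Definition frob (e : nat) (x : R) : R := x ^+ (p ^ e).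

Definition frob_power (e : nat) (I : set R) : set R := ideal_gen (frob e @` I).

Definition tight_closure (I : set R) : set R :=
  [set u | exists2 d, ring_circ R d & exists e0, forall e, (e0 <= e)%N ->
     frob_power e I (d * frob e u)].

(* F^e(M) *)
Definition frob_mod (e : nat) (M : lmodType R) : lmodType R :=
  base_change (frob e) M.

(* u^q *)
Definition frob_elt (e : nat) (M : lmodType R) (u : M) : frob_mod e M :=
  tensor (frob e) 1 u.

Arguments frob_elt e {M} u.

(* N^{[q]}: the elements of F^e(N) are the finite sums of tensors             *)
(* b \otimes n, so the image of F^e(N) in F^e(M) consists of the finite sums  *)
(* of tensors b \otimes n, with n in N, computed in F^e(M).                   *)
Definition frob_power_mod (e : nat) (M : lmodType R) (N : set M) :
    set (frob_mod e M) :=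
  [set t | exists2 s : seq (R * M), (forall x, x \in s -> N x.2) &
     t = \sum_(x <- s) tensor (frob e) x.1 x.2].

Arguments frob_power_mod e {M} N.

Definition tight_closure_mod (M : lmodType R) (N : set M) : set M :=
  [set u | exists2 d, ring_circ R d & exists e0, forall e, (e0 <= e)%N ->
     frob_power_mod e N (d *: frob_elt e u)].

Definition test_element (c : R) : Prop :=
  ring_circ R c /\
  forall (M : lmodType R) (N : set M),
    fg_module M -> submodule N -> fg_submodule N ->
    forall u : M, tight_closure_mod N u <->
      forall e : nat, frob_power_mod e N (c *: frob_elt e u).

End TightClosure.

Section StablePrimes.
Variables (p : nat) (R : comPzRingType).

Definition locally_stable_test_element (c : R) : Prop :=
  test_element p c /\
  forall P : prime_ideal R, test_element p (to_loc (prime_compl P) c).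

Definition square_locally_stable_test_element (c : R) : Prop :=
  exists2 d : R, locally_stable_test_element d & c = d ^+ 2.

(* x \in (I_P)^* *)
Definition mem_tight_closure_at (I : set R) (x : R) (P : prime_ideal R) : Prop :=
  tight_closure p (ideal_loc (prime_compl P) I) (to_loc (prime_compl P) x).

Definition stable_primes_at (I : set R) (x : R) : set (prime_ideal R) :=
  [set Q | ~ mem_tight_closure_at I x Q /\
     forall P : prime_ideal R, P `<` Q -> mem_tight_closure_at I x P].

Definition stable_primes (I : set R) : set (prime_ideal R) :=
  \bigcup_(x in [set: R]) stable_primes_at I x.

(* Q^{Nq} \subseteq (J_q)_Q for all q = p^e >> 0, where J e stands for J_q *)
Definition eventually_contains_pow (Q : prime_ideal R) (J : nat -> set R) : Prop :=
  exists N : nat, exists e0 : nat, forall e : nat, (e0 <= e)%N ->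
    to_loc (prime_compl Q) @` ideal_pow Q (N * p ^ e) `<=`
      ideal_loc (prime_compl Q) (J e).

End StablePrimes.

(* Main.v *)
(* Contracting tight closures of localizations to R turns everything into
   statements about saturations of the ideals I^[q], and a locally stable test
   element d turns membership in tight closures into conditions valid for all q.
   Primes of a Noetherian ring satisfy the descending chain condition, so a prime
   P with x \notin (I_P)^* contains one in T_I(x).

   Suppose (2) and let x \in (I_W)^*. Every Q in T_I(x) meets W, and as T_I(x) is
   finite some w in W lies in all of them. The containments give N such that
   y = w^N x lies in (I_Q)^* for all Q in T_I(x). Hence every prime of T_I(y)
   strictly contains one of T_I(x), so the intersection of T_I(y) is strictly
   larger than that of T_I(x), and Noetherian induction applies to y.

   Suppose (1). A prime Q in T_I(x) is minimal over I^* : x, hence associated to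
   I^*, and there are finitely many such primes. For a \in Q, all primes of
   (R_Q)_a are strictly below Q, so x becomes an element of the tight closure of
   I in this ring; by (1) some s a^k x with s \notin Q is in I^*. Applying this to
   generators of Q, the pigeonhole principle gives the containment. *)

Require Import Defs.
From HB Require Import structures.
From mathcomp Require Import all_boot all_algebra ring.
From mathcomp Require Import boolp classical_sets cardinality.

Set Implicit Arguments.
Unset Strict Implicit.
Unset Printing Implicit Defensive.

Import GRing.Theory.
Local Open Scope ring_scope.
Local Open Scope classical_set_scope.

(** * Ideals and primes of Noetherian rings *)

Section IdealTheory.
Variable R : comPzRingType.
Implicit Types (I J K : set R) (a b r u v w x y z : R) (W : mulset R).
Implicit Types (P Q : prime_ideal R).

Lemma setI0_notin (A B : set R) x : A `&` B = set0 -> A x -> ~ B x.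
Proof. by move=> AB Ax Bx; have : (A `&` B) x by []; rewrite AB. Qed.

Lemma idealI J : J 0 -> (forall a u v, J u -> J v -> J (a * u + v)) -> ideal J.
Proof. by split. Qed.

Lemma ideal0 J : ideal J -> J 0. Proof. by case. Qed.

Lemma idealDM J a u v : ideal J -> J u -> J v -> J (a * u + v).
Proof. by case=> _; apply. Qed.

Lemma idealM J a u : ideal J -> J u -> J (a * u).
Proof. by move=> iJ Ju; rewrite -[_ * _]addr0; apply: idealDM (ideal0 _). Qed.

Lemma idealMr J a u : ideal J -> J u -> J (u * a).
Proof. by rewrite mulrC; exact: idealM. Qed.

Lemma idealD J u v : ideal J -> J u -> J v -> J (u + v).
Proof. by rewrite -{2}[u]mul1r; exact: idealDM. Qed.

Lemma idealB J u v : ideal J -> J u -> J v -> J (u - v).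
Proof. by move=> iJ Ju Jv; rewrite addrC -mulN1r; exact: idealDM. Qed.

Lemma ideal_genP (A : set R) : ideal (ideal_gen A).
Proof.
split=> [J [[]]//|a u v hu hv J JA].
by case: (JA) => [[_ +] _]; apply; [exact: hu|exact: hv].
Qed.

Lemma sub_ideal_gen (A : set R) : A `<=` ideal_gen A.
Proof. by move=> x Ax J [_]; apply. Qed.

Lemma ideal_gen_sub (A : set R) J : ideal J -> A `<=` J -> ideal_gen A `<=` J.
Proof. by move=> iJ AJ x; apply. Qed.

Lemma ideal_gen_id J : ideal J -> ideal_gen J = J.
Proof.
move=> iJ; apply/seteqP; split; first exact: ideal_gen_sub.
exact: sub_ideal_gen.
Qed.

Lemma ideal_colonP J y : ideal J -> ideal (ideal_colon J y).
Proof.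
move=> iJ; apply: idealI => [|a u v]; rewrite /ideal_colon /=.
  by rewrite mul0r; exact: ideal0.
by rewrite mulrDl -mulrA; exact: idealDM.
Qed.

(* The preimage in R of the extension of J to the localization R_W. *)
Definition sat W J : set R := [set r | exists2 w, mulset_set W w & J (w * r)].

Lemma satP W J : ideal J -> ideal (sat W J).
Proof.
move=> iJ; apply: idealI => [|a u v [w Ww Ju] [w' Ww' Jv]].
  by exists 1; [exact: mulset1|rewrite mulr0; exact: ideal0].
exists (w * w'); first exact: mulsetM.
have -> : w * w' * (a * u + v) = w' * a * (w * u) + w * (w' * v) by ring.
by apply: idealDM => //; exact: idealM.
Qed.

Lemma sub_sat W J : J `<=` sat W J.
Proof. by move=> r Jr; exists 1; [exact: mulset1|rewrite mul1r]. Qed.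

Lemma sat_idem W (V : mulset R) J : (V : set R) `<=` W ->
  sat V (sat W J) `<=` sat W J.
Proof.
move=> VW r [w /VW Ww [w' Ww' Jr]]; exists (w' * w); first exact: mulsetM.
by rewrite -mulrA.
Qed.

Lemma sat_mono W J K : J `<=` K -> sat W J `<=` sat W K.
Proof. by move=> JK r [w Ww /JK]; exists w. Qed.

Definition adjoin J a : set R := [set r | exists2 v, J v & exists t, r = v + t * a].

Lemma adjoinP J a : ideal J -> ideal (adjoin J a).
Proof.
move=> iJ; apply: idealI => [|b u v [u' Ju [t ->]] [v' Jv [t' ->]]].
  by exists 0; [exact: ideal0|exists 0; rewrite mul0r addr0].
exists (b * u' + v'); first exact: idealDM.
by exists (b * t + t'); ring.
Qed.

Lemma sub_adjoin J a : J `<=` adjoin J a.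
Proof. by move=> r Jr; exists r => //; exists 0; rewrite mul0r addr0. Qed.

Lemma mem_adjoin J a : ideal J -> adjoin J a a.
Proof. by move=> iJ; exists 0; [exact: ideal0|exists 1; rewrite mul1r add0r]. Qed.

Lemma adjoin_sub J K a : ideal K -> J `<=` K -> K a -> adjoin J a `<=` K.
Proof.
by move=> iK JK Ka _ [v Jv [t ->]]; rewrite addrC; apply: idealDM; last exact: JK.
Qed.

Lemma adjoin_mono J K a : J `<=` K -> adjoin J a `<=` adjoin K a.
Proof. by move=> JK r [v /JK]; exists v. Qed.

Lemma prime_idealP P : ideal P. Proof. by case: (prime_setP P). Qed.

Lemma prime_ideal1 P : ~ (P : set R) 1. Proof. by case: (prime_setP P). Qed.

Lemma prime_idealM P a b : (P : set R) (a * b) -> (P : set R) a \/ (P : set R) b.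
Proof. by case: (prime_setP P) => _ _; exact. Qed.

Lemma prime_idealX P a n : (P : set R) (a ^+ n) -> (P : set R) a.
Proof.
elim: n => [|n IHn]; first by move/prime_ideal1.
by rewrite exprS => /prime_idealM[].
Qed.

Lemma mulsetX W a n : mulset_set W a -> mulset_set W (a ^+ n).
Proof.
move=> Wa; elim: n => [|n IHn]; first exact: mulset1.
by rewrite exprS; exact: mulsetM.
Qed.

(* The multiplicative set inverted in (R_P)_a. *)
Lemma powers_compl1 P a :
  [set w | exists2 s, ~ (P : set R) s & exists k, w = s * a ^+ k] 1.
Proof. by exists 1; [exact: prime_ideal1|exists 0; rewrite mulr1]. Qed.

Lemma powers_complM P a u v :
  let W := [set w | exists2 s, ~ (P : set R) s & exists k, w = s * a ^+ k] in
  W u -> W v -> W (u * v).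
Proof.
move=> W [s Ps [k ->]] [t Pt [l ->]]; exists (s * t).
  exact: prime_complM.
by exists (k + l)%N; rewrite exprD; ring.
Qed.

Definition powers_compl P a : mulset R :=
  MulSet (@powers_compl1 P a) (@powers_complM P a).

Lemma powers_compl_disjoint P Q a : (Q : set R) `&` powers_compl P a = set0 ->
  (Q : set R) `<=` P /\ ~ (Q : set R) a.
Proof.
move=> QW; split=> [r Qr|Qa].
  apply: contrapT => Pr; apply: (setI0_notin QW Qr).
  by exists r => //; exists 0; rewrite mulr1.
apply: (setI0_notin QW Qa); exists 1; first exact: prime_ideal1.
by exists 1; rewrite mul1r.
Qed.

(** * Maximal ideals in families, primes missing a multiplicative set, prime colons *)

Section Noetherian.
Hypothesis noethR : noetherian R.

Lemma noetherian_fg J : ideal J -> exists s : seq R, J = ideal_gen [set` s].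
Proof. by move/noethR. Qed.

(** If no member of [F] above [J0] were maximal, choice would build a strictly increasing chain; its
    union is a finitely generated ideal, hence already reached by one member. *)
Lemma noetherian_max (F : set (set R)) J0 :
  (forall J, F J -> ideal J) -> F J0 ->
  exists J, [/\ F J, J0 `<=` J & forall K, F K -> J `<=` K -> K `<=` J].
Proof.
move=> Fid FJ0; apply: contrapT => nomax.
have next (T : {J | F J /\ J0 `<=` J}) :
    exists U : {J | F J /\ J0 `<=` J}, sval T `<` sval U.
  case: T => J [FJ J0J] /=; apply: contrapT => noU; apply: nomax.
  exists J; split=> // K FK JK; apply: contrapT => nKJ; apply: noU.
  by exists (exist _ K (conj FK (subset_trans J0J JK))).
have [f fP] := choice next.
pose g n := iter n f (exist _ J0 (conj FJ0 (@subset_refl _ J0))).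
have gS n : sval (g n) `<` sval (g n.+1) by exact: fP.
have gid n : ideal (sval (g n)) by apply: Fid; case: (svalP (g n)).
have gmono m n : (m <= n)%N -> sval (g m) `<=` sval (g n).
  move=> /subnK <-; elim: (n - m)%N => [|k IHk]; first exact: subset_refl.
  by apply: subset_trans IHk _; case: (gS (k + m)%N).
pose U := \bigcup_n sval (g n).
have Uid : ideal U.
  apply: idealI => [|a u v [m _ gu] [n _ gv]].
    by exists 0%N => //; exact: ideal0.
  exists (m + n)%N => //; apply: idealDM => //; apply: gmono gu || apply: gmono gv.
    by rewrite leq_addr.
  by rewrite leq_addl.
have [s sE] := noetherian_fg Uid.
have [n sn] : exists n, forall x, x \in s -> sval (g n) x.
  have : forall x, x \in s -> U x by move=> x xs; rewrite sE; exact: sub_ideal_gen.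
  elim: s {sE} => [_|x s IHs Us]; first by exists 0%N.
  have [n sn] := IHs (fun y ys => Us y (@mem_behead _ (x :: s) y ys)).
  have [m _ gx] := Us x (mem_head x s).
  exists (m + n)%N => y; rewrite inE => /orP[/eqP->|/sn].
    by apply: gmono gx; rewrite leq_addr.
  by apply: gmono; rewrite leq_addl.
have [_] := gS n; apply => r gr.
have : U r by exists n.+1.
rewrite sE; apply: ideal_gen_sub => // x; exact: sn.
Qed.

Lemma noetherian_ind (H : set R -> Prop) :
  (forall J, ideal J -> (forall K, ideal K -> J `<` K -> H K) -> H J) ->
  forall J, ideal J -> H J.
Proof.
move=> IH J iJ; apply: contrapT => nHJ.
have [K [[iK nHK] _ Kmax]] :=
  @noetherian_max [set K | ideal K /\ ~ H K] J (fun _ => @proj1 _ _) (conj iJ nHJ).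
apply: nHK; apply: IH => // L iL [KL nLK].
by apply: contrapT => nHL; apply: nLK; exact: Kmax.
Qed.

(** An ideal [K] maximal among those that miss [W] is prime: for [a] and [b] outside [K], both
    [adjoin K a] and [adjoin K b] meet [W], and the product of the two meeting elements would lie in
    [K] if [a * b] did. *)
Lemma prime_disjoint W J : ideal J -> J `&` W = set0 ->
  exists2 P : prime_ideal R, J `<=` P & (P : set R) `&` W = set0.
Proof.
move=> iJ JW.
have [K [[iK KW] JK Kmax]] :=
  @noetherian_max [set K | ideal K /\ K `&` W = set0] J (fun _ => @proj1 _ _)
    (conj iJ JW).
have meet x : ~ K x -> exists2 w, mulset_set W w & adjoin K x w.
  move=> nKx; apply: contrapT => nW; apply: nKx.
  apply: (Kmax (adjoin K x)); last exact: mem_adjoin.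
    split; first exact: adjoinP.
    by apply/seteqP; split=> // w [Kw Ww]; apply: nW; exists w.
  exact: sub_adjoin.
have Kpr : is_prime K.
  split=> // [K1|a b Kab].
    exact: setI0_notin KW K1 (mulset1 W).
  apply: contrapT => /not_orP[/meet[w Ww [u Ku [r wE]]] /meet[w' Ww' [v Kv [t wE']]]].
  apply: (setI0_notin KW _ (mulsetM Ww Ww')).
  have -> : w * w' = w' * u + (r * a * v + r * t * (a * b)).
    by rewrite {1}wE wE'; ring.
  by apply: idealDM => //; apply: idealD => //; exact: idealM.
by exists (PrimeIdeal Kpr).
Qed.

Lemma local_meet W J : ideal J ->
  (forall P, (P : set R) `&` W = set0 -> exists2 s, J s & ~ (P : set R) s) ->
  exists2 w, mulset_set W w & J w.
Proof.
move=> iJ loc; apply: contrapT => nJW.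
have JW : J `&` W = set0.
  by apply/seteqP; split=> // w [Jw Ww]; apply: nJW; exists w.
have [P JP PW] := prime_disjoint iJ JW.
by have [s /JP] := loc P PW.
Qed.

(** A maximal ideal among the colons of multiples of [y] outside [J] is prime: if [b] is not in the
    colon of [r * y], then the colon of [b * (r * y)] cannot be larger. This is the existence of
    associated primes. *)
Lemma prime_colon J y : ideal J -> ~ J y ->
  exists2 r, ~ J (r * y) & is_prime (ideal_colon J (r * y)).
Proof.
move=> iJ Jy.
have [||K [[r Jr ->] _ Kmax]] := @noetherian_max
    [set K | exists2 r, ~ J (r * y) & K = ideal_colon J (r * y)] (ideal_colon J y).
- by move=> _ [r _ ->]; exact: ideal_colonP.
- by exists 1; rewrite mul1r.
exists r => //; split; [exact: ideal_colonP|by rewrite /ideal_colon /= mul1r|].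
move=> a b; rewrite /ideal_colon /= => Jab.
case: (pselect (J (b * (r * y)))) => [|Jb]; [by right|left].
apply: (Kmax (ideal_colon J (b * (r * y)))).
- by exists (b * r); rewrite -?mulrA.
- by move=> x; rewrite /ideal_colon /= [x * (b * _)]mulrCA; exact: idealM.
- by rewrite /ideal_colon /= mulrA.
Qed.

End Noetherian.
End IdealTheory.

(** * Krull's principal ideal theorem and the descending chain condition *)

Section Krull.
Variable R : comPzRingType.
Hypothesis noethR : noetherian R.
Implicit Types (J K M N : set R) (a b r u v w x y z : R) (P Q : prime_ideal R).

Local Notation psat P := (sat (prime_compl P)).

(* R_P / J R_P is Artinian when P is minimal over J; all ideals of R_P are
   represented by their preimages in R. *)
Lemma artinian_stab P J : ideal J -> psat P J `<=` J ->
  (forall Q, J `<=` Q -> (Q : set R) `<=` P -> (P : set R) `<=` Q) ->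
  forall C : nat -> set R,
    (forall n, [/\ ideal (C n), psat P (C n) `<=` C n, J `<=` C n
                 & C n.+1 `<=` C n]) ->
    exists n0, forall n, (n0 <= n)%N -> C n `<=` C n.+1.
Proof.
move: J; apply: (noetherian_ind noethR) => J iJ IH Jsat Pmin C HC.
case: (pselect (J 1)) => [J1|nJ1].
  exists 0%N => n _ r _; case: (HC n.+1) => iC _ JC _.
  by rewrite -[r]mulr1; apply: idealM => //; exact: JC.
have [z Jz Jzp] := prime_colon noethR iJ nJ1; rewrite mulr1 in Jz Jzp.
(* [z] spans a copy of the residue field at [P]: the prime [J : z] lies in [P] because [J] is
   saturated, so it contains [P] by minimality. *)
have PJz : (P : set R) `<=` ideal_colon J z.
  apply: (Pmin (PrimeIdeal Jzp)) => [r Jr|s Jsz].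
    by rewrite /= /ideal_colon /=; exact: idealMr.
  by apply: contrapT => Ps; apply: Jz; apply: Jsat; exists s.
have Cmono m n : (m <= n)%N -> C n `<=` C m.
  move=> /subnK <-; elim: (n - m)%N => [|k IHk]; first exact: subset_refl.
  by apply: subset_trans IHk; case: (HC (k + m)%N).
have iJz := adjoinP z iJ.
have [||||n0 stab] := IH (psat P (adjoin J z)) (satP _ iJz) _ _ _
    (fun n => psat P (adjoin (C n) z)).
- split; first by apply: subset_trans (@sub_sat _ _ _); exact: sub_adjoin.
  by move/(_ z); apply: contra_not Jz; apply; apply: sub_sat; exact: mem_adjoin.
- exact: sat_idem.
- move=> Q JQ; apply: Pmin; apply: subset_trans JQ.
  by apply: subset_trans (@sub_sat _ _ _); exact: sub_adjoin.
- move=> n; case: (HC n) => iC Csat JC CS; split.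
  + by apply: satP; exact: adjoinP.
  + exact: sat_idem.
  + by apply: sat_mono; exact: adjoin_mono.
  + by apply: sat_mono; exact: adjoin_mono.
(* If every [C n] contains [z], adjoining it changes nothing. Otherwise [z] is outside [C n] from
   [n1] on, which forces the coefficient [t] of [z] into [P], so that [t * z] is in [J]. *)
case: (pselect (forall n, C n z)) => [Cz|/existsNP[n1 nCz]].
  exists n0 => n n0n; apply: subset_trans.
    by apply: subset_trans (@sub_sat _ (prime_compl P) _); exact: (@sub_adjoin _ _ z).
  apply: subset_trans (stab n n0n) _.
  case: (HC n.+1) => iC Csat _ _; apply: subset_trans Csat.
  by apply: sat_mono; apply: adjoin_sub.
exists (n0 + n1)%N => n /[dup] /(leq_trans (leq_addr _ _)) n0n.
move=> /(leq_trans (leq_addl _ _)) n1n u Cu.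
have [|s Ps [v Cv [t su]]] := stab n n0n u.
  by apply: sub_sat; exact: sub_adjoin.
case: (HC n) => iC Csat JC CS; case: (HC n.+1) => iC' Csat' JC' _.
have Pt : (P : set R) t.
  apply: contrapT => Pt; apply: nCz; apply: (Cmono _ _ n1n); apply: Csat.
  exists t => //; have -> : t * z = s * u - v by rewrite su; ring.
  by apply: idealB => //; [exact: idealM|exact: CS].
apply: Csat'; exists s => //; rewrite su; apply: idealD => //.
by apply: JC'; exact: PJz.
Qed.

(** Nakayama's lemma at [P], for [M] inside [N + a M]. Let [K] be maximal among the saturated ideals
    over [N] not containing [M]. Adjoining to [K] some [u] in [M] outside [K] absorbs [M], which
    puts [(t * s - a * r) * u] in [K] with a coefficient outside [P]. *)
Lemma nakayama_sat P M N a : ideal N -> psat P N `<=` N -> (P : set R) a ->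
  (forall u, M u -> exists s u', [/\ ~ (P : set R) s, M u' & N (s * u - a * u')]) ->
  M `<=` N.
Proof.
move=> iN Nsat Pa MN; apply: contrapT => nMN.
have [K [[iK Ksat nMK] NK Kmax]] := @noetherian_max _ noethR
  [set K | [/\ ideal K, psat P K `<=` K & ~ M `<=` K]] N
  (fun J '(And3 iJ _ _) => iJ) (And3 iN Nsat nMN).
apply: nMK => u Mu; apply: contrapT => nKu.
pose L := psat P (adjoin K u).
have KL : K `<=` L by apply: subset_trans (@sub_sat _ _ _); exact: sub_adjoin.
have iKu : ideal (adjoin K u) by exact: adjoinP.
have ML : M `<=` L.
  apply: contrapT => nML; apply: nKu; apply: (Kmax L) => //.
    by split=> //; [exact: satP|exact: sat_idem].
  by apply: sub_sat; exact: mem_adjoin.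
have [s [u' [Ps /ML[t Pt [k Kk [r tu']]] Nsu]]] := MN u Mu.
apply: nKu; apply: Ksat; exists (t * s - a * r).
  move=> Pd; suff /prime_idealM[] : (P : set R) (t * s) by [].
  rewrite -[t * s](subrK (a * r)); apply: idealD => //; first exact: prime_idealP.
  by apply: idealMr => //; exact: prime_idealP.
have -> : (t * s - a * r) * u = t * (s * u - a * u') + a * k.
  have -> : a * k = a * (t * u') - a * r * u by rewrite tu'; ring.
  by ring.
by apply: idealDM => //; [exact: NK|exact: idealM].
Qed.

(* The ideals sat_Q(P0 + (b^n)) play the role of the symbolic powers of Q. *)
Lemma principal_ideal_theorem (P0 Q P : prime_ideal R) a :
  (P0 : set R) `<` Q -> (Q : set R) `<` P -> (P : set R) a ->
  exists P' : prime_ideal R,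
    [/\ (P0 : set R) `<=` P', (P' : set R) a & (P' : set R) `<` P].
Proof.
move=> [P0Q nQP0] [QP nPQ] Pa; apply: contrapT => noP'.
have iP0 := prime_idealP P0; have iQ := prime_idealP Q; have iP := prime_idealP P.
have nQa : ~ (Q : set R) a by move=> Qa; apply: noP'; exists Q.
have [b Qb nP0b] : exists2 b, (Q : set R) b & ~ (P0 : set R) b.
  apply: contrapT => nb; apply: nQP0 => b Qb.
  by apply: contrapT => nP0b; apply: nb; exists b.
pose D n := psat Q (adjoin P0 (b ^+ n)).
have iD n : ideal (D n) by apply: satP; exact: adjoinP.
have DS n : D n.+1 `<=` D n.
  apply: sat_mono; apply: adjoin_sub; first exact: adjoinP.
    exact: sub_adjoin.
  by rewrite exprS; apply: idealM; [exact: adjoinP|exact: mem_adjoin].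
have P0D n : (P0 : set R) `<=` D n.
  by apply: subset_trans (@sub_sat _ _ _); exact: sub_adjoin.
have complPQ : (prime_compl P : set R) `<=` prime_compl Q by move=> s Ps /QP.
have iP0a := adjoinP a iP0.
(* [noP'] says that [P] is minimal over [adjoin P0 a], so the chain of the [adjoin (D n) a]
   stabilizes at [P]. *)
have [|||n stab] := @artinian_stab P (psat P (adjoin P0 a)) (satP _ iP0a) _ _
    (fun n => psat P (adjoin (D n) a)).
- exact: sat_idem.
- move=> P' JP' P'P; apply: contrapT => nPP'; apply: noP'; exists P'; split=> //.
    apply: subset_trans JP'.
    by apply: subset_trans (@sub_sat _ _ _); exact: sub_adjoin.
  by apply: JP'; apply: sub_sat; exact: mem_adjoin.
- move=> n; split.
  + by apply: satP; exact: adjoinP.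
  + exact: sat_idem.
  + by apply: sat_mono; exact: adjoin_mono.
  + by apply: sat_mono; exact: adjoin_mono.
(* Locally at [P], [D n] lies in [D n.+1 + a D n]: the term [t * a] is in [D n], which is saturated
   at [Q], and [a] is outside [Q], so [t] is in [D n]. *)
have DD : D n `<=` D n.+1.
  apply: (@nakayama_sat P _ _ a) => //; first exact: sat_idem.
  move=> u Du; have [||s Ps [v Dv [t su]]] := stab n _ u => //.
    by apply: sub_sat; exact: sub_adjoin.
  exists s, t; split=> //; last by rewrite su mulrC addrK.
  apply: (@sat_idem _ (prime_compl Q) (prime_compl Q)); first exact: subset_refl.
  exists a => //; rewrite mulrC; have -> : t * a = s * u - v by rewrite su; ring.
  by apply: (idealB (iD n)); [exact: (idealM _ (iD n))|exact: DS].
(* As [b ^+ n] is in [D n.+1], the product [(s - t * b) * b ^+ n] falls into [P0], although neither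
   [b] nor [s - t * b] is in [P0]. *)
have [|s nQs [v P0v [t sb]]] := DD (b ^+ n).
  by apply: sub_sat; exact: mem_adjoin.
have : (P0 : set R) ((s - t * b) * b ^+ n).
  have -> : (s - t * b) * b ^+ n = v by rewrite mulrBl sb exprS; ring.
  by [].
move=> /prime_idealM[/P0Q Qd|/prime_idealX//]; apply: nQs.
by rewrite -[s](subrK (t * b)); apply: idealD => //; exact: idealM.
Qed.

(** Follows the proof of Krull's height theorem: a prime minimal over [n] elements is accessible, by
    induction on [n], and every prime is minimal over its own generators. *)
Lemma prime_acc P : Acc (fun Q Q' : prime_ideal R => (Q : set R) `<` Q') P.
Proof.
have [s sE] := noetherian_fg noethR (prime_idealP P).
suff minacc n : forall (l : seq R) P, size l = n ->
    (forall x, x \in l -> (P : set R) x) ->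
    (forall Q, (forall x, x \in l -> (Q : set R) x) -> (Q : set R) `<=` P ->
       (P : set R) `<=` Q) ->
    Acc (fun Q Q' : prime_ideal R => (Q : set R) `<` Q') P.
  apply: (minacc _ s) => // [x xs|Q Qs _]; first by rewrite sE; exact: sub_ideal_gen.
  by rewrite sE; apply: ideal_gen_sub; [exact: prime_idealP|exact: Qs].
elim: n => [|n IHn] {s sE}l {}P.
  move=> /size0nil -> _ Pmin; constructor=> Q [QP nPQ].
  by case: nPQ; apply: Pmin.
move=> size_l Pl Pmin; constructor=> Q0 [Q0P nPQ0].
(* [Q0] is raised to a prime [Q] maximal strictly below [P]. For an [a] in [l] outside [Q], the only
   prime between [adjoin Q a] and [P] is then [P]. *)
have [||_ [[Q -> [QP nPQ]] Q0Q Qmax]] := @noetherian_max _ noethR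
  [set K : set R | exists2 Q : prime_ideal R, K = Q & (Q : set R) `<` P] Q0.
- by move=> _ [Q -> _]; exact: prime_idealP.
- by exists Q0.
suff accQ : Acc (fun Q Q' : prime_ideal R => (Q : set R) `<` Q') Q.
  constructor=> P1 [P1Q0 nQ0P1]; apply: (Acc_inv accQ); split.
    exact: subset_trans Q0Q.
  by move=> QP1; apply: nQ0P1; exact: subset_trans QP1.
have [a al nQa] : exists2 a, a \in l & ~ (Q : set R) a.
  apply: contrapT => nl; apply: nPQ; apply: Pmin => // x xl.
  by apply: contrapT => nQx; apply: nl; exists x.
have iQa := adjoinP a (prime_idealP Q).
have over P' : (Q : set R) `<=` P' -> (P' : set R) a -> (P' : set R) `<=` P ->
    (P : set R) `<=` P'.
  move=> QP' P'a P'P; apply: contrapT => nPP'; apply: nQa.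
  by apply: (Qmax P') => //; exists P'.
(* Up to a factor outside [P], some power of [x] is congruent modulo [a] to an element [b] of [Q].
   These [b] form the list for [Q], shorter by one. *)
have powers x : exists b, (P : set R) x ->
    (Q : set R) b /\ forall P' : prime_ideal R, (P' : set R) `<=` P ->
      (P' : set R) a -> (P' : set R) b -> (P' : set R) x.
  case: (pselect ((P : set R) x)) => [Px|]; last by exists 0.
  suff [_ [s nPs [k ->]] [b Qb [t sx]]] :
      exists2 w, mulset_set (powers_compl P x) w & adjoin Q a w.
    exists b => _; split=> // P' P'P P'a P'b.
    have : (P' : set R) (s * x ^+ k).
      rewrite sx; apply: idealD => //; first exact: prime_idealP.
      by apply: idealM => //; exact: prime_idealP.
    by move=> /prime_idealM[/P'P//|/prime_idealX].
  apply: local_meet => // P' /powers_compl_disjoint[P'P nP'x].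
  apply: contrapT => nP'; apply: nP'x.
  have QaP' : adjoin Q a `<=` P'.
    by move=> y Qay; apply: contrapT => nP'y; apply: nP'; exists y.
  apply: over => //; first by apply: subset_trans QaP'; exact: sub_adjoin.
  by apply: QaP'; apply: mem_adjoin; exact: prime_idealP.
have [f fP] := choice powers.
have Pf x : x \in rem a l -> (P : set R) x by move/mem_rem; exact: Pl.
apply: (IHn [seq f x | x <- rem a l] Q).
- by rewrite size_map size_rem // size_l.
- by move=> _ /mapP[x /Pf Px ->]; case: (fP x Px).
(* A prime [P1] strictly below [Q] with all the [f x] would lie in a [P'] strictly below [P] that
   contains [a], hence all of [l], against the minimality of [P]. *)
move=> P1 P1f P1Q; apply: contrapT => nQP1.
have [P' [P1P' P'a [P'P nPP']]] :=
  principal_ideal_theorem (conj P1Q nQP1) (conj QP nPQ) (Pl a al).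
apply: nPP'; apply: Pmin => // x xl; case: (eqVneq x a) => [->//|xa].
have xr : x \in rem a l by move: xl; rewrite (perm_mem (perm_to_rem al)) inE (negPf xa).
have [_] := fP x (Pf x xr); apply=> //; apply: P1P'; apply: P1f.
exact: map_f.
Qed.

End Krull.

(** * Finitely many primes *)

Lemma finite_bound (T : eqType) (A : set T) (H : T -> nat -> Prop) :
  finite_set A -> (forall x m n, (m <= n)%N -> H x m -> H x n) ->
  (forall x, A x -> exists n, H x n) -> exists n, forall x, A x -> H x n.
Proof.
move=> /finite_seqP[s ->] Hmono; elim: s => [|x s IHs] Hs; first by exists 0%N.
have [n Hn] := IHs (fun y ys => Hs y (@mem_behead _ (x :: s) y ys)).
have [m Hm] := Hs x (mem_head x s).
exists (m + n)%N => y /=; rewrite inE => /orP[/eqP->|/Hn].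
  by apply: Hmono Hm; rewrite leq_addr.
by apply: Hmono; rewrite leq_addl.
Qed.

(** Classical equality, so that finite sets of primes can be enumerated by lists. *)
HB.instance Definition _ (R : comPzRingType) := gen_eqMixin (prime_ideal R).

Section FinitelyManyPrimes.
Variable R : comPzRingType.
Implicit Types (J B : set R) (a b r u v w x y z : R) (P Q : prime_ideal R).

Lemma prime_ideal_ext P Q : (P : set R) = Q -> P = Q.
Proof.
case: P Q => [P hP] [Q hQ] /= PQ; case: _ / PQ hQ => hQ.
by rewrite (Prop_irrelevance hP hQ).
Qed.

Lemma finite_primes_meet (W : mulset R) (A : set (prime_ideal R)) : finite_set A ->
  (forall Q, A Q -> exists2 w, mulset_set W w & (Q : set R) w) ->
  exists2 w, mulset_set W w & forall Q, A Q -> (Q : set R) w.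
Proof.
move=> /finite_seqP[s ->]; elim: s => [|Q s IHs] AW.
  by exists 1 => //; exact: mulset1.
have [w Ww sw] := IHs (fun P Ps => AW P (@mem_behead _ (Q :: s) P Ps)).
have [v Wv Qv] := AW Q (mem_head Q s).
exists (v * w); first exact: mulsetM.
move=> P /=; rewrite inE => /orP[/eqP->|/sw Pw].
  by apply: idealMr => //; exact: prime_idealP.
by apply: idealM => //; exact: prime_idealP.
Qed.

(** * Associated primes *)

Section Associated.
Hypothesis noethR : noetherian R.

(** Noetherian induction: with [J : z] prime, an associated prime of [J] either is [J : z] or is
    associated to the larger ideal [adjoin J z]. *)
Lemma finite_associated J : ideal J ->
  finite_set [set Q : prime_ideal R | exists y, (Q : set R) = ideal_colon J y].
Proof.
move: J; apply: (noetherian_ind noethR) => J iJ IH.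
case: (pselect (J 1)) => [J1|nJ1].
  suff -> : [set Q : prime_ideal R | exists y, (Q : set R) = ideal_colon J y] = set0.
    exact: finite_set0.
  apply/seteqP; split=> // Q [y QJ]; apply: (@prime_ideal1 _ Q).
  by rewrite QJ /ideal_colon /= mulrC; exact: idealM.
have [z Jz Jzp] := prime_colon noethR iJ nJ1; rewrite mulr1 in Jz Jzp.
have fin : finite_set [set Q : prime_ideal R |
    exists y, (Q : set R) = ideal_colon (adjoin J z) y].
  apply: IH; [exact: adjoinP|split; first exact: sub_adjoin].
  by move/(_ z); apply: contra_not Jz; apply; exact: mem_adjoin.
apply: (@sub_finite_set _ _ (PrimeIdeal Jzp |`
  [set Q : prime_ideal R |
    exists y, (Q : set R) = ideal_colon (adjoin J z) y])); last first.
  by rewrite finite_setU; split=> //; exact: finite_set1.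
move=> Q [y QJ]; have iQ := prime_idealP Q.
case: (pselect (exists2 r, adjoin J z (r * y) & ~ J (r * y))) => [|nr]; last first.
  right; exists y; rewrite QJ; apply/seteqP; split=> r; rewrite /ideal_colon /=.
    exact: sub_adjoin.
  by move=> Jzr; apply: contrapT => nJr; apply: nr; exists r.
move=> [r [j Jj [t ry]] nJry]; left; apply: prime_ideal_ext => /=.
have nQr : ~ (Q : set R) r by rewrite QJ.
have nJt : ~ ideal_colon J z t.
  by move=> Jt; apply: nJry; rewrite ry; apply: idealD.
(* [Q] is also the colon of [r * y], which is [t * z] modulo [J]. The colon of [t * z] is that of
   [z], since [J : z] is prime and does not contain [t]. *)
have QE x : (Q : set R) x <-> J (x * (t * z)).
  have -> : x * (t * z) = x * r * y - x * j by rewrite -mulrA ry; ring.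
  have xrE : J (x * r * y - x * j) <-> (Q : set R) (x * r).
    rewrite QJ /ideal_colon /=; split=> [Jx|Jx].
      by rewrite -[_ * y](subrK (x * j)); apply: idealD => //; exact: idealM.
    by apply: idealB => //; exact: idealM.
  rewrite xrE; split=> [Qx|/prime_idealM[]//]; exact: idealMr.
apply/seteqP; split=> x; rewrite /= QE mulrA.
  by move=> /(prime_idealM (P := PrimeIdeal Jzp))[].
by move=> Jx; rewrite -mulrA mulrCA; exact: idealM.
Qed.

(** With [K] the preimage of [J R_Q], some multiple [y] of [x] has a prime colon [K : y] inside [Q].
    Were it smaller, the hypothesis at that prime would give an [s] outside it with [s * x] in [J],
    hence [s * y] in [K]. Clearing denominators for the generators of [Q] leads from [K] to [J]. *)
Lemma minimal_over_colon_associated J Q x : ideal J ->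
  ~ sat (prime_compl Q) J x ->
  (forall P, (P : set R) `<` Q -> sat (prime_compl P) J x) ->
  exists y, (Q : set R) = ideal_colon J y.
Proof.
move=> iJ nQx Px; pose K := sat (prime_compl Q) J.
have iK : ideal K by exact: satP.
have [r nKrx Krxp] := prime_colon noethR iK nQx; set y := r * x in nKrx Krxp.
have KyQ : ideal_colon K y `<=` Q.
  move=> s Ksy; apply: contrapT => nQs; apply: nKrx.
  by apply: (@sat_idem _ (prime_compl Q) (prime_compl Q)) => //; exists s.
have QKy : (Q : set R) `<=` ideal_colon K y.
  apply: contrapT => nQKy; have [s nKs Jsx] := Px (PrimeIdeal Krxp) (conj KyQ nQKy).
  apply: nKs; apply: sub_sat; rewrite /y mulrCA; exact: idealM.
have [l lE] := noetherian_fg noethR (prime_idealP Q).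
have [s nQs sl] : exists2 s, ~ (Q : set R) s & forall q, q \in l -> J (s * (q * y)).
  have : forall q, q \in l -> K (q * y).
    by move=> q ql; apply: QKy; rewrite lE; exact: sub_ideal_gen.
  elim: l {lE} => [|q l IHl] lK; first by exists 1 => //; exact: prime_ideal1.
  have [s nQs sl] := IHl (fun y ys => lK y (@mem_behead _ (q :: l) y ys)).
  have [t nQt Jt] := lK q (mem_head q l).
  exists (s * t); first exact: prime_complM.
  move=> q'; rewrite inE => /orP[/eqP->|/sl Js].
    by rewrite -mulrA; exact: idealM.
  by rewrite [s * t]mulrC -mulrA; exact: idealM.
exists (s * y); apply/seteqP; split=> q.
  rewrite {1}lE; apply: ideal_gen_sub; first exact: ideal_colonP.
  by move=> q' /sl; rewrite /ideal_colon /= mulrCA.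
rewrite /ideal_colon /= mulrCA => Jq.
by apply: KyQ; exists s.
Qed.

End Associated.

Lemma ideal_gen_cons a (s : seq R) :
  ideal_gen [set` a :: s] `<=` adjoin (ideal_gen [set` s]) a.
Proof.
have iS := ideal_genP [set` s].
apply: ideal_gen_sub; first exact: adjoinP.
move=> x /=; rewrite inE => /orP[/eqP->|xs]; first exact: mem_adjoin.
by apply: sub_adjoin; exact: sub_ideal_gen.
Qed.

(* Pigeonhole: a long product of elements of (s) contains a high power of a
   generator. *)
Lemma ideal_gen_prod B (s : seq R) m : ideal B -> (forall a, a \in s -> B (a ^+ m)) ->
  forall l : seq R, (forall x, x \in l -> ideal_gen [set` s] x) ->
  (m * size s < size l)%N -> B (\prod_(x <- l) x).
Proof.
move=> iB; elim: s => [_ [|x l] // sl _|a s IHs sB l].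
  have : ideal_gen [set` [::]] x by apply: sl; rewrite mem_head.
  have i0 : ideal [set 0 : R].
    by apply: idealI => // b u v -> ->; rewrite mulr0 addr0.
  move=> /(ideal_gen_sub i0)-> //; rewrite big_cons mul0r; exact: ideal0.
have {}IHs := IHs (fun b bs => sB b (@mem_behead _ (a :: s) b bs)).
(* Factors are expanded one by one: [j] counts the copies of [a] taken out, [l1] collects parts in
   the ideal of [s], and [l2] holds the factors still to be expanded. The total
   [j + size l1 + size l2] is preserved. *)
suff mixed j (l1 l2 : seq R) : (forall x, x \in l1 -> ideal_gen [set` s] x) ->
    (forall x, x \in l2 -> ideal_gen [set` a :: s] x) ->
    (m * (size s).+1 < j + size l1 + size l2)%N ->
    B (a ^+ j * \prod_(x <- l1) x * \prod_(x <- l2) x).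
  move=> sl ml; have := mixed 0%N [::] l; rewrite big_nil expr0 !mul1r.
  by apply.
elim: l2 j l1 => [|x l2 IHl] j l1 l1s l2s ml.
  (* Either [a ^+ m] divides the product, or [j < m] leaves more than [m * size s] factors in
     [l1]. *)
  rewrite big_nil mulr1; case: (leqP m j) => [/subnK <-|jm].
    apply: idealMr => //; rewrite exprD; apply: idealM => //.
    by apply: sB; rewrite mem_head.
  apply: idealM => //; apply: IHs => //; move: ml jm; rewrite /= addn0 mulnS.
  by move=> ml jm; rewrite -(ltn_add2l m) (leq_trans ml) // leq_add2r ltnW.
have [v sv [t xE]] := ideal_gen_cons (l2s x (mem_head x l2)).
have l2s' y : y \in l2 -> ideal_gen [set` a :: s] y.
  by move=> yl; apply: l2s; rewrite inE yl orbT.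
rewrite big_cons xE.
have -> : a ^+ j * \prod_(y <- l1) y * ((v + t * a) * \prod_(y <- l2) y) =
    t * (a ^+ j.+1 * \prod_(y <- l1) y * \prod_(y <- l2) y) +
    a ^+ j * \prod_(y <- v :: l1) y * \prod_(y <- l2) y.
  by rewrite big_cons exprS; ring.
apply: idealDM => //; apply: IHl => //.
- by move: ml; rewrite /= addSn addSn addnS.
- by move=> y; rewrite inE => /orP[/eqP->|/l1s].
- by move: ml; rewrite /= !addnS addSn.
Qed.

End FinitelyManyPrimes.

(** * Ideals, primes and tight closure in a localization *)

Section LocalizedIdeals.
Variables (R : comPzRingType) (W : mulset R).
Implicit Types (I J : set R) (r x : R) (P Q : prime_ideal R).

Local Notation den := {w : R | w \in (W : set R)}.

Lemma loc_fracD r r' (w w' : den) :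
  loc_frac r w + loc_frac r' w' = loc_frac (r * val w' + r' * val w) (denM w w').
Proof. exact: loc_addE. Qed.

Lemma loc_fracM r r' (w w' : den) :
  loc_frac r w * loc_frac r' w' = loc_frac (r * r') (denM w w').
Proof. exact: loc_mulE. Qed.

Lemma loc_frac_eq r r' (w w' : den) : r * val w' = r' * val w ->
  loc_frac r w = loc_frac r' w'.
Proof. by move=> e; apply/loc_eqP; exists 1; [exact: mulset1|rewrite e]. Qed.

Lemma to_locD : {morph to_loc W : r r' / r + r'}.
Proof. by move=> r r'; rewrite loc_fracD; apply: loc_frac_eq; rewrite /= !mulr1. Qed.

Lemma to_locM : {morph to_loc W : r r' / r * r'}.
Proof. by move=> r r'; rewrite loc_fracM; apply: loc_frac_eq; rewrite /= !mulr1. Qed.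

Lemma to_locX r n : to_loc W (r ^+ n) = to_loc W r ^+ n.
Proof. by elim: n => // n IHn; rewrite !exprS to_locM IHn. Qed.

Lemma to_loc_natr n : to_loc W n%:R = n%:R.
Proof. by elim: n => // n IHn; rewrite !mulrS to_locD IHn. Qed.

Lemma loc_fracE r (w : den) : loc_frac r w = loc_frac 1 w * to_loc W r.
Proof. by rewrite loc_fracM; apply: loc_frac_eq; rewrite /= mulr1 mul1r. Qed.

Lemma to_loc_fracE r (w : den) : to_loc W r = to_loc W (val w) * loc_frac r w.
Proof. by rewrite loc_fracM; apply: loc_frac_eq; rewrite /=; ring. Qed.

Lemma mulset_unit w : mulset_set W w -> exists u, u * to_loc W w = 1.
Proof.
move=> Ww; exists (loc_frac 1 (exist _ w (mem_set Ww))).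
by rewrite -loc_fracE; apply: loc_frac_eq; rewrite /= mulr1 mul1r.
Qed.

(** Fractions with numerator in [J] already form an ideal of [R_W], so every element of the
    extension is a single such fraction. *)
Lemma ideal_loc_fracP J r (w : den) : ideal J ->
  ideal_loc W J (loc_frac r w) <-> sat W J r.
Proof.
move=> iJ; split=> [Jr|[v Wv Jvr]]; last first.
  have [u uv] := mulset_unit Wv.
  have -> : loc_frac r w = loc_frac 1 w * u * to_loc W (v * r).
    by rewrite to_locM mulrA -[_ * u * _]mulrA uv mulr1 -loc_fracE.
  apply: (idealM _ (ideal_genP _)).
  by apply: sub_ideal_gen; exists (v * r).
suff [r' Jr' [w' /loc_eqP[t Wt e]]] :
    exists2 r', J r' & exists w' : den, loc_frac r w = loc_frac r' w'.
  exists (t * val w'); first by apply: mulsetM => //; exact: denP.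
  have -> : t * val w' * r = t * val w * r' by rewrite mulrAC -mulrA e; ring.
  exact: idealM.
pose K := [set a | exists2 r', J r' & exists w' : den, a = loc_frac r' w'].
suff iK : ideal K.
  by apply: (ideal_gen_sub iK) Jr => _ [r' Jr' <-]; exists r' => //; exists (den1 W).
apply: idealI; first by exists 0; [exact: ideal0|exists (den1 W)].
elim/loc_ind=> s v _ _ [r1 Jr1 [w1 ->]] [r2 Jr2 [w2 ->]].
rewrite loc_fracM loc_fracD; eexists; last by eexists.
by apply: idealD => //; apply: idealMr => //; exact: idealM.
Qed.

Lemma ideal_locP J r : ideal J -> ideal_loc W J (to_loc W r) <-> sat W J r.
Proof. exact: ideal_loc_fracP. Qed.

Lemma ideal_loc_fg J : @fg_submodule R R^o J ->
  @fg_submodule (loc W) (loc W)^o (ideal_loc W J).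
Proof.
move=> [s ->]; exists [seq to_loc W x | x <- s].
rewrite -/(ideal_gen [set` s]) -/(ideal_gen [set` [seq to_loc W x | x <- s]]).
apply/seteqP; split; apply: ideal_gen_sub; try exact: ideal_genP.
  suff gen : ideal_gen [set` s] `<=`
      [set r | ideal_gen [set` [seq to_loc W x | x <- s]] (to_loc W r)].
    by move=> _ [r /gen Jr <-].
  have iG := ideal_genP [set` [seq to_loc W x | x <- s]].
  apply: ideal_gen_sub => [|x xs]; last first.
    by apply: sub_ideal_gen; exact: map_f.
  apply: idealI => [|a u v Ju Jv] /=; first exact: (ideal0 iG).
  by rewrite to_locD to_locM; exact: (idealDM _ iG).
move=> _ /mapP[x xs ->]; apply: sub_ideal_gen; exists x => //.
exact: sub_ideal_gen.
Qed.

Lemma contraction_prime (PP : prime_ideal (loc W)) :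
  is_prime [set r | (PP : set (loc W)) (to_loc W r)].
Proof.
have iP := prime_idealP PP; split=> [||a b] /=.
- apply: idealI => [|a u v Pu Pv] /=; first exact: (ideal0 iP).
  by rewrite to_locD to_locM; exact: (idealDM _ iP).
- exact: prime_ideal1.
- by rewrite to_locM => /prime_idealM.
Qed.

Lemma contraction_disjoint (PP : prime_ideal (loc W)) :
  (PrimeIdeal (contraction_prime PP) : set R) `&` W = set0.
Proof.
apply/seteqP; split=> // w [/= Pw /mulset_unit[u uw]].
apply: (@prime_ideal1 _ PP); rewrite -uw.
exact: (idealM _ (prime_idealP PP)).
Qed.

Lemma sat_prime P : (P : set R) `&` W = set0 -> sat W P = P.
Proof.
move=> PW; apply/seteqP; split; last exact: sub_sat.
by move=> r [w Ww /prime_idealM[Pw|//]]; case: (setI0_notin PW Pw).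
Qed.

Lemma extension_prime P : (P : set R) `&` W = set0 -> is_prime (ideal_loc W P).
Proof.
move=> PW; have iP := prime_idealP P.
split=> [||]; first exact: ideal_genP.
  by rewrite -[1]/(to_loc W 1) ideal_locP // sat_prime //; exact: prime_ideal1.
elim/loc_ind=> a u; elim/loc_ind=> b v.
by rewrite loc_fracM !ideal_loc_fracP // sat_prime //; exact: prime_idealM.
Qed.

(* The minimal primes of R_W are the extensions of those of R that miss W. *)
Lemma ring_circ_loc r (w : den) : ring_circ (loc W) (loc_frac r w) <->
  forall P, minimal_prime P -> (P : set R) `&` W = set0 -> ~ (P : set R) r.
Proof.
split=> [circ P Pmin PW Pr|circ [PP PPmin PPr]].
  apply: circ; exists (PrimeIdeal (extension_prime PW)) => /=; last first.
    by apply/ideal_loc_fracP; [exact: prime_idealP|rewrite sat_prime].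
  move=> QQ /= QQP; have iQQ := prime_idealP QQ.
  apply: ideal_gen_sub => // _ [s Ps <-].
  apply: (Pmin (PrimeIdeal (contraction_prime QQ))) => // t /= /QQP.
  by rewrite ideal_locP ?sat_prime //; exact: prime_idealP.
pose P := PrimeIdeal (contraction_prime PP).
apply: (circ P); last 1 first.
- by rewrite /= (to_loc_fracE _ w); exact: (idealM _ (prime_idealP PP)).
- move=> Q QP; have QW : (Q : set R) `&` W = set0.
    apply/seteqP; split=> // s [/QP Ps Ws].
    exact: setI0_notin (contraction_disjoint PP) Ps Ws.
  have QWPP : PrimeIdeal (extension_prime QW) `<=` PP.
    by apply: ideal_gen_sub; [exact: prime_idealP|move=> _ [s /QP Ps <-]].
  move=> s /= /(PPmin _ QWPP) /=.
  by rewrite ideal_locP ?sat_prime //; exact: prime_idealP.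
exact: contraction_disjoint.
Qed.

(** * Frobenius powers and tight closure in a localization *)

Variable p : nat.

Lemma frob_loc_frac e x (w : den) :
  exists v : den, frob p e (loc_frac x w) = loc_frac (frob p e x) v.
Proof.
rewrite /frob; elim: (p ^ e)%N => [|n [v IHn]]; first by exists (den1 W).
by rewrite !exprS IHn loc_fracM; eexists.
Qed.

Lemma frob_power_loc e J : ideal J ->
  frob_power p e (ideal_loc W J) = ideal_loc W (frob_power p e J).
Proof.
move=> iJ; have iF := ideal_genP (frob p e @` J).
apply/seteqP; split; apply: ideal_gen_sub; try exact: ideal_genP.
  move=> _ [a Ja <-]; elim/loc_ind: a Ja => x w.
  rewrite ideal_loc_fracP // => -[v Wv Jx].
  have [w' ->] := frob_loc_frac e x w; apply/ideal_loc_fracP => //.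
  exists (frob p e v); first exact: mulsetX.
  by apply: sub_ideal_gen; exists (v * x) => //; rewrite /frob exprMn.
have iG := ideal_genP (frob p e @` ideal_loc W J).
suff gen : frob_power p e J `<=`
    [set r | frob_power p e (ideal_loc W J) (to_loc W r)].
  by move=> _ [r /gen Jr <-].
apply: ideal_gen_sub => [|_ [x Jx <-]].
  apply: idealI => [|a u v Ju Jv] /=; first exact: (ideal0 iG).
  by rewrite to_locD to_locM; exact: (idealDM _ iG).
rewrite /= /frob to_locX; apply: sub_ideal_gen; exists (to_loc W x) => //.
by apply: sub_ideal_gen; exists x.
Qed.

(* The contraction to R of the tight closure of J R_W. *)
Definition tight_closure_in J : set R := [set x | exists2 d,
  (forall P, minimal_prime P -> (P : set R) `&` W = set0 -> ~ (P : set R) d) &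
  exists e0, forall e, (e0 <= e)%N -> sat W (frob_power p e J) (d * frob p e x)].

Lemma tight_closure_locP J x (w : den) : ideal J ->
  tight_closure p (ideal_loc W J) (loc_frac x w) <-> tight_closure_in J x.
Proof.
move=> iJ; have iF e := ideal_genP (frob p e @` J).
have fracE d (v : den) e :
    frob_power p e (ideal_loc W J) (loc_frac d v * frob p e (loc_frac x w)) <->
    sat W (frob_power p e J) (d * frob p e x).
  have [w' ->] := frob_loc_frac e x w; rewrite frob_power_loc // loc_fracM.
  exact: (ideal_loc_fracP _ _ (iF e)).
split=> [[a]|[d circ [e0 Jx]]]; last first.
  exists (to_loc W d); first exact/ring_circ_loc.
  by exists e0 => e /Jx; rewrite fracE.
elim/loc_ind: a => d v /ring_circ_loc circ [e0 Jx].
by exists d => //; exists e0 => e /Jx; rewrite fracE.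
Qed.

End LocalizedIdeals.

(** * Frobenius powers and test elements *)

Section TestElements.
Variables (p : nat) (A : comPzRingType).
Hypotheses (p_pr : prime p) (pA : p%:R = 0 :> A).
Implicit Types (J : set A) (c d u x : A).

Lemma frobD e : {morph frob p e : x y / x + y >-> x + y :> A}.
Proof.
have addp (x y : A) : (x + y) ^+ p = x ^+ p + y ^+ p.
  rewrite exprDn -(prednK (prime_gt0 p_pr)) big_ord_recl big_ord_recr /=.
  rewrite big1 ?add0r => [|i _].
    by rewrite subn0 expr0 mulr1 bin0 subnn expr0 mul1r binn !mulr1n.
  rewrite (prednK (prime_gt0 p_pr)) -mulr_natr.
  have /dvdnP[k ->] : (p %| 'C(p, bump 0 i))%N.
    by apply: prime_dvd_bin => //; rewrite /bump /= add1n -ltn_predRL ltn_ord.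
  by rewrite natrM pA !mulr0.
move=> x y; rewrite /frob; elim: e => [|e IHe]; first by rewrite !expr1.
by rewrite expnSr !exprM IHe addp.
Qed.

Lemma frobM e : {morph frob p e : x y / x * y >-> x * y :> A}.
Proof. by move=> x y; rewrite /frob exprMn. Qed.

Lemma frob0 e : frob p e (0 : A) = 0.
Proof. by rewrite /frob expr0n expn_eq0 -[p == 0%N]negbK -lt0n prime_gt0. Qed.

Lemma frob_powerP e J : ideal (frob_power p e J). Proof. exact: ideal_genP. Qed.

Lemma frob_power0 J : ideal J -> frob_power p 0 J = J.
Proof.
move=> iJ; rewrite -[RHS]ideal_gen_id //; congr ideal_gen.
apply/seteqP; split=> [_ [x Jx <-]|x Jx]; first by rewrite /frob expr1.
by exists x => //; rewrite /frob expr1.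
Qed.

(* F^e(A) is A itself, through b \otimes m |-> b m^q. *)
Definition untensor_pre e (s : seq (A * A)) : A := \sum_(z <- s) z.1 * frob p e z.2.

(** Splitting the module argument is respected because Frobenius is additive in characteristic [p],
    moving a scalar across because it is multiplicative. *)
Lemma untensor_cong e (s t : seq (A * A^o)) :
  tensor_cong (frob p e) s t -> untensor_pre e s = untensor_pre e t.
Proof.
rewrite /untensor_pre; elim=> {s t} //=.
- by move=> s t u _ -> _ ->.
- by move=> s s' t t' _ es _ et; rewrite !big_cat /= es et.
- by move=> s t; rewrite !big_cat /= addrC.
- by move=> m; rewrite big_seq1 big_nil mul0r.
- by move=> b b' m; rewrite !big_cons !big_nil /= !addr0 mulrDl.
- by move=> b m m'; rewrite !big_cons !big_nil /= !addr0 frobD mulrDr.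
- by move=> a b m; rewrite !big_seq1 /= [a *: m]/(a * m) frobM mulrA.
Qed.

Definition untensor e (t : frob_mod p e A^o) : A := untensor_pre e (repr t).

Lemma untensor_class e (s : seq (A * A^o)) :
  untensor (bc_class (frob p e) s) = untensor_pre e s.
Proof. by apply: untensor_cong; exact: bc_reprP. Qed.

Lemma untensorD e : {morph @untensor e : s t / s + t}.
Proof.
elim/bc_ind=> s; elim/bc_ind=> t.
have -> : bc_class (frob p e) s + bc_class (frob p e) t = bc_class (frob p e) (s ++ t).
  exact: bc_addE.
by rewrite !untensor_class /untensor_pre big_cat.
Qed.

Lemma untensor_tensor e b (m : A^o) : untensor (tensor (frob p e) b m) = b * frob p e m.
Proof. by rewrite untensor_class /untensor_pre big_seq1. Qed.

Lemma untensor0 e : untensor (0 : frob_mod p e A^o) = 0.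
Proof.
have -> : (0 : frob_mod p e A^o) = bc_class (frob p e) [::] by [].
by rewrite untensor_class /untensor_pre big_nil.
Qed.

Lemma scale_tensor e c (b : A) (m : A^o) :
  c *: (tensor (frob p e) b m : frob_mod p e A^o) = tensor (frob p e) (c * b) m.
Proof. exact: bc_scaleE. Qed.

Lemma tensor_frob e b (m : A^o) :
  tensor (frob p e) b m = tensor (frob p e) (b * frob p e m) (1 : A^o).
Proof.
apply/bc_classP; apply: tensor_sym.
have := @tensor_scale _ _ (frob p e) A^o m b 1.
by have -> : m *: (1 : A^o) = m by exact: mulr1.
Qed.

(** Identifies the module version of the Frobenius power, for [J] inside [A], with the ideal
    version. One direction applies [untensor]; for the other, the [v] whose tensor with 1 is in the
    module version form an ideal containing the [q]-th powers from [J]. *)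
Lemma frob_power_modP e J u c : ideal J ->
  @frob_power_mod p A e A^o J (c *: @frob_elt p A e A^o u) <->
  frob_power p e J (c * frob p e u).
Proof.
move=> iJ; have iF := frob_powerP e J.
rewrite /frob_elt scale_tensor mulr1; split=> [[s sJ sE]|Ju].
  rewrite -(@untensor_tensor e c u) sE.
  elim: s sJ {sE} => [_|x s IHs sJ].
    by rewrite big_nil untensor0; exact: (ideal0 iF).
  rewrite big_cons untensorD; apply: (idealD iF); last first.
    by apply: IHs => y ys; apply: sJ; rewrite inE ys orbT.
  rewrite untensor_tensor; apply: (idealM _ iF); apply: sub_ideal_gen.
  by exists x.2 => //; apply: sJ; exact: mem_head.
rewrite tensor_frob; move: (c * _) Ju.
pose K := [set v : A | @frob_power_mod p A e A^o J (tensor (frob p e) v (1 : A^o))].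
suff iK : ideal K.
  apply: (ideal_gen_sub iK) => _ [x Jx <-]; exists [:: (1, x)].
    by move=> y; rewrite inE => /eqP->.
  by rewrite big_seq1 /= [RHS]tensor_frob mul1r.
apply: idealI => [|a v w [s sJ sE] [t tJ tE]].
  exists [::] => //; rewrite big_nil; apply/bc_classP; exact: tensor_zero.
exists ([seq (a * z.1, z.2) | z <- s] ++ t).
  by move=> x; rewrite mem_cat => /orP[/mapP[y ys ->]|]; [exact: (sJ _ ys)|exact: tJ].
rewrite big_cat big_map /= -tE.
have -> : \sum_(z <- s) tensor (frob p e) (a * z.1) z.2 =
    a *: (\sum_(z <- s) tensor (frob p e) z.1 z.2 : frob_mod p e A^o).
  by rewrite scaler_sumr; apply: eq_bigr => x _; rewrite scale_tensor.
rewrite -sE scale_tensor.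
have -> : tensor (frob p e) (a * v) (1 : A^o) + tensor (frob p e) w (1 : A^o) =
    bc_class (frob p e) [:: (a * v, 1 : A^o); (w, 1 : A^o)] by exact: bc_addE.
apply/bc_classP; exact: tensor_addl.
Qed.

Lemma test_element_ideal c J u : test_element p c -> ideal J ->
  @fg_submodule A A^o J ->
  tight_closure p J u <-> forall e, frob_power p e J (c * frob p e u).
Proof.
move=> [_ test] iJ fgJ.
have fgA : fg_module (A^o : lmodType A).
  exists [:: 1]; rewrite -/(ideal_gen [set` [:: 1 : A]]); apply/seteqP; split=> // x _.
  have i1 := ideal_genP [set` [:: 1 : A]].
  rewrite -[x]mulr1; apply: (idealM _ i1); apply: sub_ideal_gen.
  exact: mem_head.
have := test A^o J fgA iJ fgJ u.
have -> : tight_closure_mod p (M := A^o) J u <-> tight_closure p J u.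
  split=> -[d dc [e0 Ju]]; exists d => //; exists e0 => e /Ju;
  by rewrite frob_power_modP.
move=> ->; split=> Ju e; have := Ju e; by rewrite frob_power_modP.
Qed.

End TestElements.

(** * Stable primes *)

Section StablePrimeTheory.
Variables (p : nat) (R : comPzRingType) (c d : R) (I : set R).
Hypotheses (p_pr : prime p) (pR : p%:R = 0 :> R) (noethR : noetherian R).
Hypotheses (test_d : locally_stable_test_element p d) (cE : c = d ^+ 2).
Hypothesis iI : ideal I.
Implicit Types (J : set R) (a b r u v w x y z : R) (P Q : prime_ideal R).
Implicit Types (W : mulset R).

Local Notation tc := (tight_closure p).
Local Notation T := (stable_primes_at p I).
Local Notation F e := (frob_power p e I).
Local Notation psat P := (sat (prime_compl P)).
Local Notation mem_at := (mem_tight_closure_at p).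

Lemma test_tight_closure J x : ideal J ->
  tc J x <-> forall e, frob_power p e J (d * frob p e x).
Proof.
by move=> iJ; apply: (test_element_ideal p_pr pR); [case: test_d| |exact: noethR].
Qed.

(** The image of [d] is a test element of [R_P], so one multiplier from [R] serves all primes and
    all exponents. *)
Lemma test_mem_at P x :
  mem_at I x P <-> forall e, psat P (F e) (d * frob p e x).
Proof.
have pRP : p%:R = 0 :> loc (prime_compl P).
  by rewrite -to_loc_natr pR.
rewrite /mem_tight_closure_at.
rewrite (test_element_ideal p_pr pRP _ (proj2 test_d P)); last 2 first.
- exact: ideal_genP.
- by apply: ideal_loc_fg; exact: noethR.
have FE e : frob_power p e (ideal_loc (prime_compl P) I)
    (to_loc (prime_compl P) d * frob p e (to_loc (prime_compl P) x)) <->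
    psat P (F e) (d * frob p e x).
  rewrite frob_power_loc // /frob -to_locX -to_locM.
  exact: (ideal_locP _ _ (frob_powerP p e I)).
by split=> Ix e; have := Ix e; rewrite FE.
Qed.

Lemma mem_atP P x : mem_at I x P <-> tight_closure_in (prime_compl P) p I x.
Proof. exact: tight_closure_locP. Qed.

Lemma minimal_prime_test P : minimal_prime P -> ~ (P : set R) d.
Proof. by case: test_d => -[dR _] _ Pmin Pd; apply: dR; exists P. Qed.

(** With [d] as common multiplier, closure under sums reduces to additivity of Frobenius. *)
Lemma tight_closureP J : ideal J -> ideal (tc J).
Proof.
move=> iJ; apply: idealI => [|a u v].
  apply/(test_tight_closure _ iJ) => e; rewrite frob0 // mulr0.
  exact: (ideal0 (frob_powerP _ _ _)).
rewrite !test_tight_closure // => Ju Jv e.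
rewrite (frobD p_pr pR) frobM mulrDr mulrCA.
exact: (idealDM _ (frob_powerP _ _ _)).
Qed.

Lemma sub_tight_closure J : ideal J -> J `<=` tc J.
Proof.
move=> iJ x Jx; apply/(test_tight_closure _ iJ) => e.
apply: (idealM _ (frob_powerP _ _ _)).
by apply: sub_ideal_gen; exists x.
Qed.

(** Otherwise some [J : (r * y)] is prime; at that prime an [s] outside it sends [y] into [J], which
    puts [s] inside. *)
Lemma local_mem J y : ideal J -> (forall P, psat P J y) -> J y.
Proof.
move=> iJ Jy; apply: contrapT => nJy.
have [r _ Jrp] := prime_colon noethR iJ nJy.
have [s nJs Jsy] := Jy (PrimeIdeal Jrp).
by apply: nJs; rewrite /= /ideal_colon /= mulrCA; exact: idealM.
Qed.

Lemma tight_closure_local x : (forall P, mem_at I x P) -> tc I x.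
Proof.
move=> Ix; apply/(test_tight_closure _ iI) => e.
apply: local_mem => [|P]; first exact: frob_powerP.
exact: (proj1 (test_mem_at P x) (Ix P) e).
Qed.

(** The multiplier [d] is fixed, so for each exponent [local_meet] turns membership at the primes
    missing [W] into a denominator in [W]. *)
Lemma tight_closure_in_local W x :
  (forall P, (P : set R) `&` W = set0 -> mem_at I x P) ->
  tight_closure_in W p I x.
Proof.
move=> Ix; exists d; first by move=> P /minimal_prime_test.
exists 0%N => e _; have iC := ideal_colonP (d * frob p e x) (frob_powerP p e I).
apply: (local_meet noethR iC) => P /Ix/test_mem_at/(_ e)[s nPs Fs].
by exists s.
Qed.

Lemma tight_closure_in_mem_at W P x : (P : set R) `&` W = set0 ->
  tight_closure_in W p I x -> mem_at I x P.
Proof.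
move=> PW [a circ [e0 Ix]]; apply/mem_atP.
have WP : (W : set R) `<=` prime_compl P.
  by move=> w Ww Pw; exact: setI0_notin PW Pw Ww.
exists a => [Q Qmin QP|].
  apply: circ => //; apply/seteqP; split=> // w [Qw /WP nPw].
  exact: setI0_notin QP Qw nPw.
by exists e0 => e /Ix[w /WP nPw Fw]; exists w.
Qed.

Lemma tight_closure_inM W a x :
  tight_closure_in W p I x -> tight_closure_in W p I (a * x).
Proof.
move=> [b circ [e0 Ix]]; exists b => //; exists e0 => e /Ix Fx.
by rewrite frobM mulrCA; exact: (idealM _ (satP W (frob_powerP p e I))).
Qed.

(** The easy inclusion of (1): a denominator [w] becomes its [q]-th power, still in [W]. *)
Lemma sat_tight_closure_in W x : sat W (tc I) x -> tight_closure_in W p I x.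
Proof.
move=> [w Ww /(test_tight_closure _ iI) Iwx]; exists d.
  by move=> P /minimal_prime_test.
exists 0%N => e _; exists (frob p e w); first exact: mulsetX.
by rewrite mulrCA -frobM; exact: Iwx.
Qed.

(** The remaining inclusion of (1), contracted to [R]. *)
Definition commutes_with_loc := forall W x,
  tight_closure_in W p I x -> sat W (tc I) x.

Lemma commutes_with_locP :
  (forall W, tc (ideal_loc W I) = ideal_loc W (tc I)) <-> commutes_with_loc.
Proof.
have iT := tight_closureP iI.
split=> [comm W x|comm W].
  by rewrite -(tight_closure_locP _ _ (den1 W) iI) comm ideal_loc_fracP.
apply/seteqP; split; elim/loc_ind=> x w;
  rewrite tight_closure_locP // ideal_loc_fracP //.
  exact: comm.
exact: sat_tight_closure_in.
Qed.

(** * Stable primes below a prime, and the implication from (2) to (1) *)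

Lemma exists_stable_prime P x : ~ mem_at I x P ->
  exists2 Q, T x Q & (Q : set R) `<=` P.
Proof.
elim: (prime_acc noethR P) => {}P _ IHP nIx.
case: (pselect (T x P)) => [TP|nTP]; first by exists P.
have [Q QP nIQ] : exists2 Q : prime_ideal R, (Q : set R) `<` P & ~ mem_at I x Q.
  apply: contrapT => nQ; apply: nTP; split=> // Q QP.
  by apply: contrapT => nIQ; apply: nQ; exists Q.
have [Q' TQ' Q'Q] := IHP Q QP nIQ.
by exists Q' => //; apply: subset_trans Q'Q _; case: QP.
Qed.

(** As [x] also fails at [Q], some prime of [T x] lies in [Q]; it differs from [Q] because [a * x]
    fails at [Q] but not at the primes of [T x]. *)
Lemma stable_prime_above a x Q : (forall P, T x P -> mem_at I (a * x) P) ->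
  T (a * x) Q -> exists2 P, T x P & (P : set R) `<` Q.
Proof.
move=> Iax [nIQ _]; have nIx : ~ mem_at I x Q.
  by apply: contra_not nIQ; rewrite !mem_atP; exact: tight_closure_inM.
have [P TP PQ] := exists_stable_prime nIx; exists P => //; split=> // QP.
apply: nIQ; suff -> : Q = P by exact: Iax.
by apply: prime_ideal_ext; apply/seteqP.
Qed.

Lemma containment_power x Q w :
  eventually_contains_pow p Q (fun e => ideal_colon (tc (F e)) (c * frob p e x)) ->
  (Q : set R) w ->
  exists n e0, forall e, (e0 <= e)%N ->
    psat Q (F e) (w ^+ (n * p ^ e) * (d * c * frob p e x)).
Proof.
move=> [n [e0 Qn]] Qw; exists n, e0 => e /Qn QE.
have iF := frob_powerP p e I.
have : psat Q (ideal_colon (tc (F e)) (c * frob p e x)) (w ^+ (n * p ^ e)).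
  apply/ideal_locP; first by apply: ideal_colonP; exact: tight_closureP.
  apply: QE; exists (w ^+ (n * p ^ e)) => //; apply: sub_ideal_gen.
  by exists (fun=> w) => //; rewrite prodr_const card_ord.
(* The test for the tight closure of [F e] is evaluated at exponent 0, where Frobenius is the
   identity; this contributes the factor [d]. *)
move=> [s nQs /(test_tight_closure _ iF)/(_ 0%N)]; rewrite frob_power0 //.
rewrite /frob expr1 => Fs; exists s => //.
by move: Fs; congr (F e _); ring.
Qed.

Lemma containment_commutes :
  (forall x, finite_set (T x)) ->
  (forall x Q, T x Q -> eventually_contains_pow p Q
     (fun e => ideal_colon (tc (F e)) (c * frob p e x))) ->
  commutes_with_loc.
Proof.
move=> fin cont W x.
pose S x := [set r | forall Q, T x Q -> (Q : set R) r].
have iS y : ideal (S y).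
  apply: idealI => [Q _|a u v Su Sv Q TQ]; first exact: (ideal0 (prime_idealP Q)).
  by apply: idealDM; [exact: prime_idealP|exact: Su|exact: Sv].
(* The induction is on the intersection [S y] of the primes of [T y], for all [y] at once. *)
suff ind K : ideal K -> forall y, K = S y ->
    tight_closure_in W p I y -> sat W (tc I) y by exact: (ind (S x)).
move: K; apply: (noetherian_ind noethR) => K _ IH {}x KE Ix.
case: (pselect (tc I x)) => [|ntx]; first exact: sub_sat.
have [Q0 TQ0] : exists Q0, T x Q0.
  have [P nIP] : exists P, ~ mem_at I x P.
    by apply/existsNP; apply: contra_not ntx; exact: tight_closure_local.
  by have [Q TQ _] := exists_stable_prime nIP; exists Q.
have [w Ww Qw] : exists2 w, mulset_set W w & forall Q, T x Q -> (Q : set R) w.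
  apply: finite_primes_meet => // Q [nIQ _]; apply: contrapT => nQW; apply: nIQ.
  apply: tight_closure_in_mem_at Ix; apply/seteqP; split=> // w [Qw Ww].
  by apply: nQW; exists w.
pose H Q n := exists e0, forall e, (e0 <= e)%N ->
    psat Q (F e) (w ^+ (n * p ^ e) * (d * c * frob p e x)).
have [n Hn] : exists n, forall Q, T x Q -> H Q n.
  apply: finite_bound => // [Q m n /subnK <- [e0 Hm]|Q TQ].
    exists e0 => e /Hm Fw; rewrite mulnDl exprD -mulrA.
    exact: (idealM _ (satP _ (frob_powerP p e I))).
  exact: containment_power (cont x Q TQ) (Qw Q TQ).
(* [w ^+ (n * p ^ e)] is the [q]-th power of [w ^+ n], and the multiplier [d * c] is a power of [d],
   so it avoids the minimal primes. *)
have Iwx Q : T x Q -> mem_at I (w ^+ n * x) Q.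
  move=> /Hn[e0 HQ]; apply/mem_atP; exists (d * c).
    move=> P /minimal_prime_test nPd _; rewrite cE -exprS.
    by apply: contra_not nPd; exact: prime_idealX.
  exists e0 => e /HQ; congr (psat Q (F e) _).
  by rewrite frobM {2}/frob -exprM; ring.
have Sx : K `<` S (w ^+ n * x).
  rewrite KE; split=> [r Sr Q TQ|SS].
    have [P TP [PQ _]] := stable_prime_above Iwx TQ.
    by apply: PQ; exact: Sr.
  (* No prime [Q] of [T (w ^+ n * x)] lies in [Q0]: the prime of [T x] strictly below [Q] would be
     strictly below [Q0], where [x] no longer fails. By finiteness one [b] outside [Q0] lies in all
     these [Q]. *)
  have [b nQ0b Sb] : exists2 b, mulset_set (prime_compl Q0) b & S (w ^+ n * x) b.
    apply: finite_primes_meet => // Q TQ; apply: contrapT => nQ.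
    have QQ0 : (Q : set R) `<=` Q0.
      by move=> r Qr; apply: contrapT => nQ0r; apply: nQ; exists r.
    have [P [nIP _] [PQ nQP]] := stable_prime_above Iwx TQ.
    apply: nIP; apply: (proj2 TQ0); split; first exact: subset_trans QQ0.
    by move=> Q0P; apply: nQP; exact: subset_trans Q0P.
  by apply: nQ0b; exact: SS Sb Q0 TQ0.
have [v Wv Iv] := IH _ (iS _) Sx _ erefl (tight_closure_inM (w ^+ n) Ix).
exists (v * w ^+ n); last by rewrite -mulrA.
by apply: mulsetM => //; exact: mulsetX.
Qed.

(** * From (1) to finiteness and containment *)

Lemma commutes_mem_at : commutes_with_loc ->
  forall P x, mem_at I x P <-> psat P (tc I) x.
Proof.
move=> comm P x; rewrite mem_atP; split; first exact: comm.
exact: sat_tight_closure_in.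
Qed.

(** For every [x], the stable primes are associated primes of the same ideal [tc I], hence
    finiteness for all [x] together. *)
Lemma commutes_finite : commutes_with_loc -> finite_set (stable_primes p I).
Proof.
move=> /commutes_mem_at memE; have iT := tight_closureP iI.
apply: sub_finite_set (finite_associated noethR iT) => Q [x _ [nIx Ix]].
apply: (minimal_over_colon_associated noethR iT (x := x)); first by rewrite -memE.
by move=> P /Ix; rewrite memE.
Qed.

Lemma commutes_containment : commutes_with_loc -> forall x Q, T x Q ->
  eventually_contains_pow p Q (fun e => ideal_colon (F e) (c * frob p e x)).
Proof.
move=> comm x Q [_ Ix]; have iT := tight_closureP iI.
have [l lE] := noetherian_fg noethR (prime_idealP Q).
pose H a k := exists2 s, ~ (Q : set R) s & tc I (s * a ^+ k * x).
have [m Hm] : exists m, forall a, a \in l -> H a m.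
  apply: (finite_bound (A := [set` l])) => [|a i j /subnK <- [s nQs Is]|a al].
  - by apply/finite_seqP; exists l.
  - exists s => //.
    have -> : s * a ^+ (j - i + i) * x = a ^+ (j - i) * (s * a ^+ i * x).
      by rewrite exprD; ring.
    exact: idealM.
  have Qa : (Q : set R) a by rewrite lE; exact: sub_ideal_gen.
  (* Primes that miss [powers_compl Q a] lie in [Q] and avoid [a], so they are strictly below [Q],
     where [x] is in the local tight closure. *)
  have [|_ [s nQs [k ->]] Isx] := comm (powers_compl Q a) x; last by exists k, s.
  apply: tight_closure_in_local => P /powers_compl_disjoint[PQ nPa].
  by apply: Ix; split=> // QP; apply: nPa; exact: QP.
(* The pigeonhole argument uses the exponent [m * p ^ e] for each generator in [l]; the successor
   makes the number of factors exceed [m * p ^ e * size l]. *)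
exists (m * size l).+1, 0%N => e _.
have iC := ideal_colonP (c * frob p e x) (frob_powerP p e I).
have iB := satP (prime_compl Q) iC.
suff powB : ideal_pow Q ((m * size l).+1 * p ^ e) `<=`
    psat Q (ideal_colon (F e) (c * frob p e x)).
  by move=> _ [r /powB Br <-]; apply/ideal_locP.
apply: (ideal_gen_sub iB) => _ [a Qa ->].
have -> : \prod_(i < (m * size l).+1 * p ^ e) a i =
    \prod_(r <- [seq a i | i <- enum 'I_((m * size l).+1 * p ^ e)]) r.
  by rewrite big_map big_enum.
apply: (ideal_gen_prod (s := l) (m := (m * p ^ e)%N) iB).
- move=> b /Hm[s nQs /(test_tight_closure _ iI)/(_ e) Fs].
  exists (frob p e s); first by move=> /prime_idealX.
  rewrite /ideal_colon /= cE.
  have -> : frob p e s * b ^+ (m * p ^ e) * (d ^+ 2 * frob p e x) =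
      d * (d * frob p e (s * b ^+ m * x)).
    by rewrite !frobM [frob p e (b ^+ m)]/frob -exprM; ring.
  exact: (idealM _ (frob_powerP p e I)).
- by move=> _ /mapP[i _ ->]; rewrite -lE.
- rewrite size_map size_enum_ord mulSn mulnAC -[X in (X < _)%N]add0n ltn_add2r.
  by rewrite expn_gt0 prime_gt0.
Qed.

End StablePrimeTheory.

Theorem theorem3p5 (p : nat) (R : comNzRingType) (c : R) (I : set R) :
  p \in [pchar R] -> reduced R -> noetherian R ->
  ring_circ R c -> square_locally_stable_test_element p c ->
  ideal I ->
  let commutes := forall W : mulset R,
    tight_closure p (ideal_loc W I) = ideal_loc W (tight_closure p I) in
  let finite_each := forall x : R, finite_set (stable_primes_at p I x) in
  let finite_all := finite_set (stable_primes p I) in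
  let containment := forall (x : R) (Q : prime_ideal R),
    stable_primes_at p I x Q ->
    eventually_contains_pow p Q (fun e =>
      ideal_colon (frob_power p e I) (c * frob p e x)) in
  let containment_tc := forall (x : R) (Q : prime_ideal R),
    stable_primes_at p I x Q ->
    eventually_contains_pow p Q (fun e =>
      ideal_colon (tight_closure p (frob_power p e I)) (c * frob p e x)) in
  [/\ commutes <-> (finite_each /\ containment),
      commutes <-> (finite_all /\ containment),
      commutes <-> (finite_each /\ containment_tc) &
      commutes <-> (finite_all /\ containment_tc)].
Proof.
move=> /andP[p_pr /eqP pR] _ noethR _ [d test_d cE] iI.
move=> commutes finite_each finite_all containment containment_tc.
(* All four equivalences come from one cycle: (1) gives the strong finiteness and the containment in
   the smaller colon, these imply the weaker versions, and the weaker versions give (1). *)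
have commE : commutes <-> commutes_with_loc p I.
  exact: (commutes_with_locP p_pr pR noethR test_d iI).
have all_each : finite_all -> finite_each.
  by move=> fin x; apply: sub_finite_set fin => Q TQ; exists x.
have cont_tc : containment -> containment_tc.
  move=> cont x Q /cont[n [e0 Qn]]; exists n, e0 => e /Qn QE.
  apply: subset_trans QE _; apply: ideal_gen_sub; first exact: ideal_genP.
  move=> _ [r Fr <-]; apply: sub_ideal_gen; exists r => //.
  exact: (sub_tight_closure p_pr pR noethR test_d (frob_powerP p e I)).
have comm_fin : commutes -> finite_all.
  move/commE; exact: (commutes_finite p_pr pR noethR test_d iI).
have comm_cont : commutes -> containment.
  move/commE; exact: (commutes_containment p_pr pR noethR test_d cE iI).
have cont_comm : finite_each -> containment_tc -> commutes.
  move=> fin cont; apply/commE.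
  exact: (containment_commutes p_pr pR noethR test_d cE iI).
by split; split; [auto|case; auto|auto|case; auto|auto|case; auto|auto|case; auto].
Qed.
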